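(* Let $m\ge 0$ be an integer and $\tau=\tau_m$ the irreducible unitary representation of $SO(3)$ on $V_\tau=H_m$. Then the algebra $(\mathbb{D}(\mathbb{R}^3)\otimes \mathrm{End}(V_\tau))^{SO(3)}$ is generated (as a unital associative algebra over $\mathbb{C}$) by $\Delta\otimes I$ and $D_\tau$, where $\Delta=\sum_{i=1}^3\frac{\partial^2}{\partial x_i^2}$ is the Laplacian on $\mathbb{R}^3$.
   Context: $H_m$ is the complex vector space of harmonic homogeneous polynomials of degree $m$ on $\mathbb{R}^3$ (dimension $2m+1$), with an $SO(3)$-invariant Hermitian inner product; $(\tau_m(k)p)(x)=p(k^{-1}\cdot x)$ for $k\in SO(3)$. $d\tau_m:so(3)\to \mathrm{End}(H_m)$ is the derived Lie algebra representation. Let $Y_1=\begin{pmatrix}0&0&0\\0&0&1\\0&-1&0\end{pmatrix}$, $Y_2=\begin{pmatrix}0&0&-1\\0&0&0\\1&0&0\end{pmatrix}$, $Y_3=\begin{pmatrix}0&1&0\\-1&0&0\\0&0&0\end{pmatrix}$ be the basis of $so(3)$ used throughout. $\mathbb{D}(\mathbb{R}^3)$ is the algebra of translation-invariant (i.e. constant coefficient, complex) scalar differential operators on $\mathbb{R}^3$. Elements of $\mathbb{D}(\mathbb{R}^3)\otimes\mathrm{End}(V_\tau)$ act on smooth $V_\tau$-valued functions on $\mathbb{R}^3$, and $(\mathbb{D}(\mathbb{R}^3)\otimes \mathrm{End}(V_\tau))^{SO(3)}$ is the subalgebra of those operators commuting with the action $(k\cdot u)(x)=\tau(k)u(k^{-1}\cdot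 x)$ of $SO(3)$. $D_\tau:=\sum_{i=1}^3\frac{\partial}{\partial x_i}\,d\tau_m(Y_i)$, and $I$ is the identity of $V_\tau$. *)

(* Defs.v *)
From HB Require Import structures.
From mathcomp Require Import all_boot all_order all_algebra.
From mathcomp Require Import boolp classical_sets functions reals topology normedtype sequences derive.
From mathcomp.multinomials Require Import -(notations) mpoly.
From mathcomp.real_closed Require Import complex.
Set Implicit Arguments. Unset Strict Implicit. Unset Printing Implicit Defensive.
Import Order.TTheory GRing.Theory Num.Theory numFieldNormedType.Exports.
Local Open Scope classical_set_scope.
Local Open Scope ring_scope.
Local Open Scope complex_scope.

Lemma mderiv_comp (K : comNzRingType) (n k : nat) (l : n.-tuple (mpoly k K))
    (j : 'I_k) (p : mpoly n K) :
  mderiv j (comp_mpoly l p) =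
  \sum_i comp_mpoly l (mderiv i p) * mderiv j (tnth l i).
Proof.
pose D (p : mpoly n K) := mderiv j (comp_mpoly l p) =
  \sum_i comp_mpoly l (mderiv i p) * mderiv j (tnth l i).
have cM : {morph comp_mpoly l : q r / q * r} by exact: rmorphM.
have DM q r : D q -> D r -> D (q * r).
  rewrite /D cM mderivM => -> ->.
  rewrite mulr_suml mulr_sumr -big_split; apply: eq_bigr => i _ /=.
  by rewrite mderivM comp_mpolyD !cM mulrDl mulrAC -!mulrA.
have D1 : D 1.
  rewrite /D comp_mpoly1 -[1]/(mpolyC k 1) mderivC big1 // => i _.
  by rewrite -[1]/(mpolyC n 1) mderivC comp_mpoly0 mul0r.
have DX i : D (mpolyX K (mnm1 i)).
  rewrite /D comp_mpolyXU -tnth_nth (bigD1 i) //= big1 ?addr0 => [|i' ne].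
    by rewrite mderivX mnm1E eqxx scale1r -{1}(add0m (mnm1 i)) addmK mpolyX0 comp_mpoly1 mul1r.
  by rewrite mderivX mnm1E eq_sym (negbTE ne) scale0r comp_mpoly0 mul0r.
rewrite -/(D p); elim/mpolyind: p => [|c a p _ _ Dp].
  by rewrite /D !(comp_mpoly0, mderiv0) big1 // => i _; rewrite mderiv0 comp_mpoly0 mul0r.
have Da : D (mpolyX K a).
  rewrite mpolyXE_id; apply: (big_ind D) => // i _.
  by elim: (a i) => [|d IH]; rewrite ?expr0 ?exprS //; apply: DM.
move: Da Dp; rewrite /D comp_mpolyD comp_mpolyZ mderivD mderivZ => -> ->.
rewrite scaler_sumr -big_split; apply: eq_bigr => i _ /=.
by rewrite mderivD mderivZ comp_mpolyD comp_mpolyZ mulrDl scalerAl.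
Qed.

Section Harmonic.
Variable R : realType.
Local Notation C := R[i].
Local Notation poly3 := (mpoly 3 C).
Local Notation homog m := (dhomog 3 C m).
Local Notation "'X_ i" := (mpolyX C (mnm1 i)).

Lemma mderiv_homog (m : nat) (i : 'I_3) (p : poly3) :
  p \is ishomog1 m mdeg -> mderiv i p \is ishomog1 m.-1 mdeg.
Proof.
move=> /dhomogP hp; apply/dhomogP => a; rewrite mcoeff_msupp mcoeff_deriv => nz.
have : mnm_add a (mnm1 i) \in msupp p.
  by rewrite mcoeff_msupp; apply: contraNneq nz => ->; rewrite mul0rn.
by move=> /hp /=; rewrite mdegD mdeg1 addn1 => <-.
Qed.

Definition mlap (p : poly3) : poly3 := \sum_(i < 3) mderiv i (mderiv i p).

Lemma mlap_homog m (p : poly3) :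
  p \is ishomog1 m mdeg -> mlap p \is ishomog1 m.-2 mdeg.
Proof. by move=> hp; apply: rpred_sum => i _; do 2!apply: mderiv_homog. Qed.

Lemma mlap_is_linear : linear mlap.
Proof.
move=> a p q; rewrite /mlap scaler_sumr -big_split /=.
by apply: eq_bigr => i _; rewrite !linearP.
Qed.
HB.instance Definition _ := GRing.isLinear.Build C poly3 poly3 _ mlap mlap_is_linear.

Definition homog_lap m (p : homog m) : homog m.-2 :=
  DHomog (mlap_homog (dhomog_is_dhomog p)).

Lemma homog_lap_is_linear m : linear (@homog_lap m).
Proof. by move=> a p q; apply/val_inj; rewrite /= linearP. Qed.
HB.instance Definition _ m :=
  GRing.isLinear.Build C (homog m) (homog m.-2) _ (@homog_lap m)
    (@homog_lap_is_linear m).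

(* Kernel of the Laplacian on homogeneous polynomials of degree m. When m < 2
   the target degree m.-2 is a dummy: the Laplacian is then zero. *)
Definition harmonics m : {vspace homog m} := lker (linfun (@homog_lap m)).

Lemma harmonicsE m (p : homog m) : (p \in harmonics m) = (mlap p == 0).
Proof. by rewrite memv_ker lfunE. Qed.

Definition Harm m : vectType C := subvs_of (harmonics m).

Definition SO3 : set 'M[R]_3 := [set k | k *m k^T = 1%:M /\ \det k = 1].

Definition linform (k : 'M[R]_3) : 3.-tuple poly3 :=
  [tuple \sum_(j < 3) (k i j)%:C *: 'X_j | i < 3].

(* p |-> p(k^-1 x); see mrotE. *)
Definition mrot (k : 'M[R]_3) (p : poly3) : poly3 :=
  comp_mpoly (linform (invmx k)) p.

Lemma mrotE k p (x : 'I_3 -> C) :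
  meval x (mrot k p) = meval (fun i => \sum_j (invmx k i j)%:C * x j) p.
Proof.
rewrite comp_mpoly_meval; apply: meval_eq => i; rewrite tnth_mktuple raddf_sum.
by apply: eq_bigr => j _ /=; rewrite mevalZ mevalXU.
Qed.

Lemma mrot_is_linear k : linear (mrot k).
Proof. by move=> a p q; rewrite /mrot linearP. Qed.

Lemma mrot_homog k m (p : poly3) :
  p \is ishomog1 m mdeg -> mrot k p \is ishomog1 m mdeg.
Proof.
move=> /dhomogP hp; rewrite /mrot comp_mpolyE big_seq; apply: rpred_sum => a /hp /= <-.
apply/rpredZ; rewrite mdegE.
apply: (big_ind2 (fun (q : poly3) d => q \is ishomog1 d mdeg)) => [|q d q' d'|i _].
- exact: dhomog1.
- exact: dhomogM.
- rewrite -[X in ishomog1 X]mul1n; apply: dhomogMn.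
  rewrite tnth_mktuple; apply: rpred_sum => j _; apply: rpredZ.
  by rewrite dhomogX /= mdeg1.
Qed.

Lemma mderiv_linform k i j : mderiv j (tnth (linform k) i) = mpolyC 3 (k i j)%:C.
Proof.
rewrite tnth_mktuple raddf_sum (bigD1 j) //= big1 ?addr0 => [|j' ne].
  by rewrite mderivZ mderivX mnm1E eqxx scale1r -{1}(add0m (mnm1 j)) addmK mpolyX0 alg_mpolyC.
by rewrite mderivZ mderivX mnm1E (negbTE ne) scale0r scaler0.
Qed.

Lemma SO3_trmx k : SO3 k -> k^T *m k = 1%:M.
Proof. by move=> [kk _]; apply: mulmx1C. Qed.

Lemma SO3_inv k : SO3 k -> invmx k = k^T.
Proof.
move=> Sk; have [kk _] := Sk; have ku : k \in unitmx by case/mulmx1_unit: kk.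
by apply: (can_inj (mulKmx ku)); rewrite mulmxV.
Qed.

Lemma mlap_mrot k p : SO3 k -> mlap (mrot k p) = mrot k (mlap p).
Proof.
move=> Sk; rewrite /mlap /mrot raddf_sum /=.
set L := linform _.
transitivity (\sum_j \sum_i \sum_i' ((invmx k i j * invmx k i' j)%:C *:
    comp_mpoly L (mderiv i' (mderiv i p)))).
  apply: eq_bigr => j _; rewrite mderiv_comp raddf_sum; apply: eq_bigr => i _ /=.
  rewrite mderiv_linform mulrC mul_mpolyC mderivZ mderiv_comp scaler_sumr.
  apply: eq_bigr => i' _; rewrite mderiv_linform mulrC mul_mpolyC scalerA.
  by rewrite -rmorphM.
rewrite exchange_big; apply: eq_bigr => i _; rewrite exchange_big /=.
have sumE i' : \sum_j invmx k i j * invmx k i' j = (i == i')%:R.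
  have -> : \sum_j invmx k i j * invmx k i' j = (invmx k *m (invmx k)^T) i i'.
    by rewrite mxE; apply: eq_bigr => j _; rewrite [in RHS]mxE.
  by rewrite SO3_inv // trmxK SO3_trmx // mxE.
have sumZ i' (q : poly3) :
    \sum_j (invmx k i j * invmx k i' j)%:C *: q = ((i == i')%:R : R)%:C *: q.
  by rewrite -scaler_suml -sumE (raddf_sum (real_complex R)).
transitivity (\sum_i' ((i == i')%:R : R)%:C *:
    comp_mpoly L (mderiv i' (mderiv i p))).
  by apply: eq_bigr => i' _; exact: sumZ.
rewrite (bigD1 i) //= eqxx.
rewrite scale1r.
rewrite big1 ?addr0 // => i' ne.
by rewrite eq_sym (negbTE ne) scale0r.
Qed.

Definition homog_rot k m (p : homog m) : homog m :=
  DHomog (mrot_homog k (dhomog_is_dhomog p)).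

Lemma homog_rot_is_linear k m : linear (@homog_rot k m).
Proof. by move=> a p q; apply/val_inj; rewrite /= mrot_is_linear. Qed.
HB.instance Definition _ k m :=
  GRing.isLinear.Build C (homog m) (homog m) _ (@homog_rot k m)
    (@homog_rot_is_linear k m).

(* vsproj only repackages the rotated polynomial as an element of the harmonic
   subspace: it is the identity there for every k in SO(3), see tauE. *)
Definition tau m (k : 'M[R]_3) : 'End(Harm m) :=
  linfun (vsproj (harmonics m) \o @homog_rot k m \o vsval).

Lemma tauE m k (p : Harm m) : SO3 k -> vsval (tau m k p) = homog_rot k (vsval p).
Proof.
move=> Sk; rewrite lfunE /= vsprojK // harmonicsE /= mlap_mrot //.
have /eqP -> : mlap (vsval p) == 0 by rewrite -harmonicsE subvsP.
by rewrite /mrot comp_mpoly0.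
Qed.
End Harmonic.

Section ComplexDerivative.
Variables (R : realType) (E : normedModType R).
Local Notation C := R[i].
Implicit Types (f g : E -> C) (x v : E).

(* R[i] carries no normed module structure over R in the library, so complex
   and vector valued maps are differentiated through real coordinates. *)
Definition cdifferentiable f x :=
  differentiable (fun y => complex.Re (f y)) x /\
  differentiable (fun y => complex.Im (f y)) x.

Definition cderive f x v : C :=
  'D_v (fun y => complex.Re (f y)) x +i* 'D_v (fun y => complex.Im (f y)) x.

Lemma cdiffP a f g x v : cdifferentiable f x -> cdifferentiable g x ->
  cdifferentiable (fun y => a * f y + g y) x /\
  cderive (fun y => a * f y + g y) x v = a * cderive f x v + cderive g x v.
Proof.
move=> [fr fi] [gr gi]; rewrite /cdifferentiable /cderive.
set fr' := fun y => complex.Re (f y) in fr *.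
set fi' := fun y => complex.Im (f y) in fi *.
set gr' := fun y => complex.Re (g y) in gr *.
set gi' := fun y => complex.Im (g y) in gi *.
case: a => ar ai.
have eR : (fun y => complex.Re ((ar +i* ai) * f y + g y)) =
          (ar *: fr' - ai *: fi') + gr'.
  apply/funext => y; rewrite -[RHS]/(ar * fr' y - ai * fi' y + gr' y) /fr' /fi' /gr'.
  by case: (f y) (g y) => [? ?] [? ?].
have eI : (fun y => complex.Im ((ar +i* ai) * f y + g y)) =
          (ar *: fi' + ai *: fr') + gi'.
  apply/funext => y; rewrite -[RHS]/(ar * fi' y + ai * fr' y + gi' y) /fr' /fi' /gi'.
  by case: (f y) (g y) => [? ?] [? ?].
have [dfr dfi] := (diff_derivable (v := v) fr, diff_derivable (v := v) fi).
have [dgr dgi] := (diff_derivable (v := v) gr, diff_derivable (v := v) gi).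
rewrite eR eI; split.
  split.
    exact (differentiableD (differentiableB (differentiableZ ar fr) (differentiableZ ai fi)) gr).
  exact (differentiableD (differentiableD (differentiableZ ar fi) (differentiableZ ai fr)) gi).
rewrite (deriveD (derivableB (derivableZ (k:=ar) dfr) (derivableZ (k:=ai) dfi)) dgr).
rewrite (deriveB (derivableZ (k:=ar) dfr) (derivableZ (k:=ai) dfi)).
rewrite (deriveD (derivableD (derivableZ (k:=ar) dfi) (derivableZ (k:=ai) dfr)) dgi).
rewrite (deriveD (derivableZ (k:=ar) dfi) (derivableZ (k:=ai) dfr)).
by rewrite (deriveZ _ dfr) (deriveZ _ dfi) (deriveZ _ dfr) (deriveZ _ dfi).
Qed.

Lemma cdiff0 x v : cdifferentiable (fun _ => 0) x /\ cderive (fun _ : E => 0 : C) x v = 0.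
Proof.
split; first by split; exact: differentiable_cst.
by rewrite /cderive /= !(derive_cst (0 : R)).
Qed.

Lemma cdiff_sum n (a : 'I_n -> C) (f : 'I_n -> E -> C) x v :
  (forall j, cdifferentiable (f j) x) ->
  cdifferentiable (fun y => \sum_j a j * f j y) x /\
  cderive (fun y => \sum_j a j * f j y) x v = \sum_j a j * cderive (f j) x v.
Proof.
move=> fd; elim: index_enum => [|j s [IH1 IH2]].
  have -> : (fun y => \sum_(j <- [::]) a j * f j y) = fun _ => 0.
    by apply/funext => y; rewrite big_nil.
  by rewrite big_nil; exact: cdiff0.
have -> : (fun y => \sum_(j <- j :: s) a j * f j y) =
          (fun y => a j * f j y + \sum_(j <- s) a j * f j y).
  by apply/funext => y; rewrite big_cons.
by rewrite big_cons -IH2; apply: cdiffP.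
Qed.

End ComplexDerivative.

Lemma cdiff_comp (R : realType) (E F : normedModType R) (L : {linear E -> F})
    (f : F -> R[i]) x v : continuous L -> cdifferentiable f (L x) ->
  cdifferentiable (f \o L) x /\ cderive (f \o L) x v = cderive f (L x) (L v).
Proof.
move=> Lc [fr fi].
have Ld : differentiable L x by exact: linear_differentiable.
have [gr gi] := (differentiable_comp Ld fr, differentiable_comp Ld fi).
split; first by split.
rewrite /cderive (deriveE _ fr) (deriveE _ fi).
have -> : (fun y => complex.Re ((f \o L) y)) = (fun y => complex.Re (f y)) \o L by [].
have -> : (fun y => complex.Im ((f \o L) y)) = (fun y => complex.Im (f y)) \o L by [].
rewrite (deriveE _ gr) (deriveE _ gi) (diff_comp Ld fr) (diff_comp Ld fi) /=.
by rewrite diff_lin.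
Qed.

Lemma cderive_sum (R : realType) (E : normedModType R) (f : E -> R[i]) x
    n (a : 'I_n -> R) (e : 'I_n -> E) : cdifferentiable f x ->
  cderive f x (\sum_j a j *: e j) = \sum_j (a j)%:C * cderive f x (e j).
Proof.
move=> [fr fi].
have -> : cderive f x = fun v => 'd (fun y => complex.Re (f y)) x v +i* 'd (fun y => complex.Im (f y)) x v.
  by apply/funext => v; rewrite /cderive !deriveE.
rewrite !linear_sum /=; elim: index_enum => [|j s IH]; first by rewrite !big_nil.
rewrite !big_cons -IH !linearZ /=; apply/eqP; rewrite eq_complex /=.
by rewrite !mul0r subr0 addr0 !eqxx.
Qed.

Section VectorDerivative.
Variables (R : realType) (V : vectType R[i]).
Local Notation C := R[i].

(* The choice of the basis vbasis {:V} is immaterial: differentiation commutes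
   with every linear map, see vdiff_lin. *)
Definition vcoord (j : 'I_(\dim {:V})) (w : V) : C := coord (vbasis {:V}) j w.

Definition vdifferentiable (E : normedModType R) (f : E -> V) (x : E) :=
  forall j, cdifferentiable (vcoord j \o f) x.

Definition vderive (E : normedModType R) (f : E -> V) (x v : E) : V :=
  \sum_j cderive (vcoord j \o f) x v *: (vbasis {:V})`_j.

Lemma vcoord_vderive (E : normedModType R) (f : E -> V) x v j :
  vcoord j (vderive f x v) = cderive (vcoord j \o f) x v.
Proof. by rewrite /vcoord coord_sum_free // (basis_free (vbasisP _)). Qed.

Lemma vcoordP (w w' : V) : (forall j, vcoord j w = vcoord j w') -> w = w'.
Proof.
move=> ww'; rewrite (coord_vbasis (memvf w)) (coord_vbasis (memvf w')).
by apply: eq_bigr => j _; rewrite -[LHS]/(vcoord j w *: _) ww'.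
Qed.
End VectorDerivative.

Lemma vdiff_lin (R : realType) (V W : vectType R[i]) (A : {linear V -> W})
    (E : normedModType R) (f : E -> V) x v : vdifferentiable f x ->
  vdifferentiable (A \o f) x /\ vderive (A \o f) x v = A (vderive f x v).
Proof.
move=> fd.
pose a k j := vcoord k (A (vbasis {:V})`_j).
have eA (k : 'I_(\dim {:W})) w :
    vcoord k (A w) = \sum_(j < \dim {:V}) a k j * vcoord j w.
  rewrite {1}(coord_vbasis (memvf w)) linear_sum /vcoord linear_sum.
  by apply: eq_bigr => j _; rewrite !linearZ mulrC.
have eAf k : vcoord k \o (A \o f) = fun y => \sum_(j < \dim {:V}) a k j * (vcoord j \o f) y.
  by apply/funext => y; rewrite /= eA.
split=> [k|]; first by rewrite eAf; apply: (cdiff_sum (a k) v fd).1.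
apply: vcoordP => k; rewrite vcoord_vderive eA eAf (cdiff_sum (a k) v fd).2.
by apply: eq_bigr => j _; rewrite vcoord_vderive.
Qed.

Lemma vdiffP (R : realType) (V : vectType R[i]) (E : normedModType R) a
    (f g : E -> V) x v : vdifferentiable f x -> vdifferentiable g x ->
  vdifferentiable (a *: f + g) x /\
  vderive (a *: f + g) x v = a *: vderive f x v + vderive g x v.
Proof.
move=> fd gd.
have e k : vcoord k \o (a *: f + g) = fun y => a * (vcoord k \o f) y + (vcoord k \o g) y.
  by apply/funext => y; rewrite /= -[(a *: f + g) y]/(a *: f y + g y) /vcoord linearP.
split=> [k|]; first by rewrite e; apply: (cdiffP _ v (fd k) (gd k)).1.
apply: vcoordP => k; rewrite vcoord_vderive e (cdiffP _ v (fd k) (gd k)).2.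
by rewrite -!vcoord_vderive /vcoord linearP.
Qed.

Section Smooth.
Variables (R : realType).
Local Notation C := R[i].
Local Notation R3 := 'cV[R]_3.

Section V.
Variable V : vectType C.
Implicit Types u : R3 -> V.

Definition partial (i : 'I_3) u : R3 -> V := fun x => vderive u x (delta_mx i 0).

(* Differentiability is total (Frechet); all orders together give C^oo. *)
Fixpoint ntimes_differentiable n u :=
  if n is n'.+1 then (forall x, vdifferentiable u x) /\
    (forall i, ntimes_differentiable n' (partial i u)) else True.

Definition smooth u := forall n, ntimes_differentiable n u.

Lemma smooth_partial i u : smooth u -> smooth (partial i u).
Proof. by move=> su n; have [_] := su n.+1; apply. Qed.

Lemma ndiffP n a u w : ntimes_differentiable n u -> ntimes_differentiable n w ->
  ntimes_differentiable n (a *: u + w).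
Proof.
elim: n u w => //= n IH u w [du pu] [dw pw]; split=> [x|i].
  by apply: (vdiffP _ x (du x) (dw x)).1.
rewrite [X in ntimes_differentiable _ X](_ : _ = a *: partial i u + partial i w).
  exact: IH.
by apply/funext => x; exact: (vdiffP _ _ (du x) (dw x)).2.
Qed.

Lemma ndiff0 n : ntimes_differentiable n (0 : R3 -> V).
Proof.
have c0 k : vcoord k \o (0 : R3 -> V) = fun _ => 0.
  by apply/funext => x; rewrite /= /vcoord linear0.
elim: n => //= n IH; split=> [x k|i]; first by rewrite c0; apply: (cdiff0 x x).1.
rewrite [X in ntimes_differentiable _ X](_ : _ = 0) //.
apply/funext => x; apply: vcoordP => k; rewrite vcoord_vderive c0 (cdiff0 _ _).2.
by rewrite /vcoord linear0.
Qed.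

Definition smooth_pred : {pred R3 -> V} := fun u => `[< smooth u >].
Lemma smooth_submod_closed : submod_closed smooth_pred.
Proof.
split=> [|a u w]; first by apply/asboolP => n; exact: ndiff0.
by move=> /asboolP su /asboolP sw; apply/asboolP => n; exact: ndiffP.
Qed.
HB.instance Definition _ := GRing.isSubmodClosed.Build C (R3 -> V) smooth_pred smooth_submod_closed.

(* C^oo(R^3, V) as a complex vector space. *)
Record smoothfun := SmoothFun { smooth_val :> R3 -> V; _ : smooth_val \in smooth_pred }.
HB.instance Definition _ := [isSub for smooth_val].
HB.instance Definition _ := [Choice of smoothfun by <:].
HB.instance Definition _ := [SubChoice_isSubZmodule of smoothfun by <:].
HB.instance Definition _ := [SubZmodule_isSubLmodule of smoothfun by <:].

Lemma smoothfunP (u : smoothfun) : smooth u.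
Proof. exact/asboolP/(valP u). Qed.

Definition smoothOf u (su : smooth u) : smoothfun := SmoothFun (asboolT su : u \in smooth_pred).

Definition partial_op i (u : smoothfun) : smoothfun :=
  smoothOf (smooth_partial i (smoothfunP u)).
End V.

Lemma ndiff_lin (V W : vectType C) (A : {linear V -> W}) n (u : R3 -> V) :
  ntimes_differentiable n u -> ntimes_differentiable n (A \o u).
Proof.
elim: n u => //= n IH u [du pu]; split=> [x|i].
  by apply: (vdiff_lin A x (du x)).1.
rewrite [X in ntimes_differentiable _ X](_ : _ = A \o partial i u); first exact: IH.
by apply/funext => x; exact: (vdiff_lin _ _ (du x)).2.
Qed.

Lemma mulmx_continuous (k : 'M[R]_3) : continuous (mulmx k : R3 -> R3).
Proof.
have -> : (mulmx k : R3 -> R3) = \sum_(j < 3) (fun x : R3 => x j 0 *: (col j k : R3)).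
  apply/funext => x; rewrite fct_sumE; apply/matrixP => i o; rewrite ord1 mxE summxE.
  by apply: eq_bigr => j _; rewrite !mxE mulrC.
move=> x; apply/differentiable_continuous/differentiable_sum => j.
exact/differentiableZl/differentiable_coord.
Qed.

Lemma ndiff_comp (V : vectType C) (k : 'M[R]_3) n (u : R3 -> V) :
  ntimes_differentiable n u -> ntimes_differentiable n (fun x => u (k *m x)).
Proof.
have kc : continuous (mulmx k : R3 -> R3) := @mulmx_continuous k.
elim: n u => //= n IH u [du pu].
have d1 x i j := @cdiff_comp R R3 R3 (mulmx k) (vcoord j \o u) x (delta_mx i 0) kc (du (k *m x) j).
split=> [x j|i]; first exact: (d1 x 0 j).1.
have ndiff_sum : forall w : 'I_3 -> R3 -> V,
    (forall j, ntimes_differentiable n (w j)) ->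
    ntimes_differentiable n (\sum_j (k j i)%:C *: w j).
  move=> w wn; elim: index_enum => [|j s IHs]; first by rewrite big_nil; exact: ndiff0.
  by rewrite big_cons; exact: ndiffP.
rewrite [X in ntimes_differentiable _ X](_ : _ =
    \sum_j (k j i)%:C *: (fun x => partial j u (k *m x))).
  by apply: ndiff_sum => j; exact: IH.
apply/funext => x; rewrite fct_sumE; apply: vcoordP => l.
rewrite vcoord_vderive (d1 x i l).2 /vcoord linear_sum /=.
have -> : k *m delta_mx i 0 = \sum_j k j i *: (delta_mx j 0 : R3).
  apply/matrixP => j o; rewrite ord1 summxE (bigD1 j) //= big1 ?addr0 => [|j' ne].
    rewrite !mxE !eqxx mulr1 (bigD1 i) //= big1 ?addr0 => [|i' ne].
      by rewrite !mxE !eqxx mulr1.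
    by rewrite !mxE (negbTE ne) mulr0.
  by rewrite !mxE (eq_sym j) (negbTE ne) mulr0.
rewrite cderive_sum; last exact: (du (k *m x) l).
apply: eq_bigr => j _.
by rewrite -vcoord_vderive -[RHS]/(vcoord l ((k j i)%:C *: partial j u (k *m x))) /vcoord linearZ.
Qed.

Definition postcomp_op (V W : vectType C) (A : {linear V -> W}) (u : smoothfun V) : smoothfun W :=
  smoothOf (fun n => ndiff_lin A (smoothfunP u n)).

Definition precomp_op (V : vectType C) (k : 'M[R]_3) (u : smoothfun V) : smoothfun V :=
  smoothOf (fun n => @ndiff_comp V k n u (smoothfunP u n)).

Section Op.
Variable V : vectType C.
Local Notation op := (smoothfun V -> smoothfun V).

(* The constant coefficient operator with symbol p, i.e. p evaluated at the
   commuting partial derivatives. *)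
Definition scalar_diffop (p : mpoly 3 C) (u : smoothfun V) : smoothfun V :=
  \sum_(a <- msupp p) mcoeff a p *:
    iter (a 0) (partial_op 0) (iter (a 1) (partial_op 1) (iter (a 2) (partial_op 2) u)).

(* The algebra D(R^3) (x) End(V), in its (faithful) action on C^oo(R^3, V): an
   element is a finite sum of pure tensors p (x) A, acting as u |-> A (p u). *)
Definition diffop : set op :=
  [set P | exists s : seq (mpoly 3 C * 'End(V)),
     P = fun u => \sum_(t <- s) postcomp_op t.2 (scalar_diffop t.1 u)].

(* Delta (x) I. *)
Definition laplacian (u : smoothfun V) : smoothfun V :=
  \sum_(i < 3) partial_op i (partial_op i u).
End Op.

(* Subsets of maps U -> U that are stable under pointwise linear combinations
   and composition; the algebra generated by linear maps consists of linear
   maps, so the ambient maps need not be restricted to endomorphisms. *)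
Definition unital_subalgebra (U : lmodType C) (S : set (U -> U)) :=
  [/\ S id, forall P Q, S P -> S Q -> S (P + Q),
      forall (a : C) P, S P -> S (a *: P) & forall P Q, S P -> S Q -> S (P \o Q)].
Definition generated_algebra (U : lmodType C) (G : set (U -> U)) :=
  smallest (@unital_subalgebra U) G.

(* Matrix exponential. *)
Definition expmx (Y : 'M[R]_3) : 'M[R]_3 :=
  lim (series (fun n => n`!%:R^-1 *: Y ^+ n) @ \oo).

(* d/dt tau(exp(tY)) at t = 0, computed in the vector space End(H_m). *)
Definition dtau m (Y : 'M[R]_3) : 'End(Harm R m) :=
  vderive (fun t : R => tau m (expmx (t *: Y))) 0 1.

Definition mx3 (s : seq (seq R)) : 'M[R]_3 :=
  \matrix_(i, j) nth 0 (nth [::] s i) j.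

Definition Y1 := mx3 [:: [:: 0;  0;  0];
                         [:: 0;  0;  1];
                         [:: 0; -1;  0]].
Definition Y2 := mx3 [:: [:: 0;  0; -1];
                         [:: 0;  0;  0];
                         [:: 1;  0;  0]].
Definition Y3 := mx3 [:: [::  0;  1;  0];
                         [:: -1;  0;  0];
                         [::  0;  0;  0]].
Definition so3_basis (i : 'I_3) : 'M[R]_3 := nth 0 [:: Y1; Y2; Y3] i.

(* (k . u)(x) = tau(k) u(k^-1 x). *)
Definition rot_act m (k : 'M[R]_3) (u : smoothfun (Harm R m)) : smoothfun (Harm R m) :=
  postcomp_op (tau m k) (precomp_op (invmx k) u).

Definition invariant_diffops m : set (smoothfun (Harm R m) -> smoothfun (Harm R m)) :=
  [set P | diffop P /\ forall k, SO3 k -> forall u, P (rot_act k u) = rot_act k (P u)].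

Definition Dtau m (u : smoothfun (Harm R m)) : smoothfun (Harm R m) :=
  \sum_(i < 3) partial_op i (postcomp_op (dtau m (so3_basis i)) u).

End Smooth.

(* Main.v *)
From HB Require Import structures.
Require Import Defs.
From mathcomp Require Import all_boot all_order all_algebra.
From mathcomp Require Import boolp classical_sets functions reals topology normedtype sequences derive.
From mathcomp Require Import exp trigo.
From mathcomp.multinomials Require Import ssrcomplements.
From mathcomp.multinomials Require Import -(notations) mpoly.
From mathcomp.real_closed Require Import complex.
From mathcomp Require Import ring lra.
Set Implicit Arguments. Unset Strict Implicit. Unset Printing Implicit Defensive.
Import Order.TTheory GRing.Theory Num.Theory.
Local Open Scope ring_scope.

(** The operator with symbol [f], a polynomial map from covectors to [End(H_m)],
   commutes with rotations exactly when
   [f (k xi) (tau k) = (tau k) (f xi)] for all real [xi] and all [k] in SO(3):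
   this is read off by applying the operator to the exponentials
   [exp (xi . x) w] ([invariant_symbol]).  Symbols multiply when operators are
   composed, because partial derivatives of smooth functions commute
   ([schwarz], [scalar_diffopM]), and a symbol is determined by its values at
   real covectors ([symbol_inj]).  The Laplacian has symbol [|xi|^2] and the
   operator [D_tau] has symbol [D xi = xi_1 dtau Y_1 + xi_2 dtau Y_2 + xi_3 dtau Y_3],
   which is equivariant ([tau_dtau_symbol]) because conjugation by a rotation
   acts on so(3) as the rotation does on R^3 ([so3_basis_conj]).  Hence the two
   operators generate invariant ones.

   Conversely, the homogeneous components of an invariant symbol are again
   equivariant, so let [f] be equivariant and homogeneous of degree [d].  Its
   value at the pole [e3] commutes with the rotations that fix the pole, hence
   with their generator [dtau Y_3].  The space [H_m] has dimension at most
   [2 m + 1], since a harmonic polynomial is determined by its restriction and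
   its normal derivative on the plane [x_3 = 0] ([harm_dim]), and [dtau Y_3]
   has [2 m + 1] distinct eigenvalues on it, obtained by lowering the vector
   [(x_1 + i x_2) ^ m] ([weight_vectors]).  So [dtau Y_3] has simple spectrum
   and [f e3] is a polynomial [sum_j a_j (dtau Y_3) ^ j] with [j <= 2 m]
   ([dtau2_commutant]).  A half turn that reverses the pole shows that only the
   exponents of the parity of [d] occur ([symbol_at_pole_parity]).  Moving the
   pole to an arbitrary covector gives
   [f xi = sum_j a_j |xi| ^ (d - j) (D xi) ^ j] ([symbol_expand]).

   It remains to exclude exponents [j > d], for which this formula is not
   polynomial.  If [J > d] is the largest one, then
   [|xi| ^ (J - d) f xi = sum_j a_j |xi| ^ (J - j) (D xi) ^ j] is an identity of
   polynomials in [xi], hence holds for complex [xi].  At an isotropic [xi] it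
   says that [a_J (D xi) ^ J = 0]; but there [D xi] is a lowering operator,
   whose powers up to [2 m] do not vanish ([lpow_isotropic_neq0]).  Therefore
   [a_J = 0], a contradiction ([expansion_degree]).  Once [j <= d] holds, the
   formula expresses the operator through powers of the Laplacian and of
   [D_tau]. *)

(** * Operators with simple spectrum *)

Section SimpleSpectrum.
Variables (K : fieldType) (V : vectType K).
Implicit Types (A B : 'End(V)) (q : {poly K}) (w : V).

Definition lpow B j : 'End(V) := iter j (fun A => (B \o A)%VF) \1%VF.

Lemma lpow0 B w : lpow B 0 w = w. Proof. by rewrite id_lfunE. Qed.
Lemma lpowS B j w : lpow B j.+1 w = B (lpow B j w). Proof. by rewrite /lpow /= comp_lfunE. Qed.

Definition lhorner q B : 'End(V) := \sum_(j < size q) q`_j *: lpow B j.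

Lemma lhornerE n q B w : (size q <= n)%N -> lhorner q B w = \sum_(j < n) q`_j *: lpow B j w.
Proof.
move=> sq; rewrite /lhorner sum_lfunE (big_ord_widen n (fun j => (q`_j *: lpow B j) w)) //.
rewrite big_mkcond; apply: eq_bigr => j _.
by case: ltnP => [_|/(nth_default 0) ->]; rewrite ?scale_lfunE ?scale0r.
Qed.

Lemma lpow_eigen B w l j : B w = l *: w -> lpow B j w = l ^+ j *: w.
Proof.
move=> Bw; elim: j => [|j IH]; first by rewrite lpow0 scale1r.
by rewrite lpowS IH linearZ /= Bw scalerA -exprSr.
Qed.

Lemma lhorner_eigen q B w l : B w = l *: w -> lhorner q B w = q.[l] *: w.
Proof.
move=> Bw; rewrite (lhornerE _ _ (leqnn _)) horner_coef scaler_suml; apply: eq_bigr => j _.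
by rewrite (lpow_eigen _ Bw) scalerA.
Qed.

(** Lagrange interpolation at the points [l j]. *)
Lemma lagrange n (l : 'I_n -> K) : injective l ->
  exists L : 'I_n -> {poly K}, forall j, (size (L j) <= n)%N /\ forall k, (L j).[l k] = (j == k)%:R.
Proof.
move=> li; pose P j := \prod_(k < n | k != j) ('X - (l k)%:P).
have Pj j : (P j).[l j] != 0.
  rewrite horner_prod; apply/prodf_neq0 => k kj; rewrite hornerXsubC subr_eq0.
  by rewrite (inj_eq li) eq_sym.
exists (fun j => (P j).[l j]^-1 *: P j) => j; split=> [|k].
  apply: leq_trans (size_scale_leq _ _) _.
  have -> : P j = \prod_(k <- enum (predC1 j)) ('X - (l k)%:P) by rewrite big_enum.
  by rewrite size_prod_XsubC /= -cardE cardC1 card_ord; case: n j {li P Pj l} => [[]|].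
rewrite hornerZ; have [<-|ne] := eqVneq; first by rewrite mulVf.
by rewrite [X in _ * X]horner_prod (bigD1 k) 1?eq_sym //= hornerXsubC subrr mul0r mulr0.
Qed.

(** Commuting with [B] forces [A] to preserve each eigenline of [B]; the polynomial
   is then found by interpolating the eigenvalues of [A] at those of [B]. *)
Lemma commutant_simple_spectrum n (B A : 'End(V)) (v : 'I_n -> V) (l : 'I_n -> K) :
  injective l -> (forall j, v j != 0) -> (forall j, B (v j) = l j *: v j) ->
  (\dim {:V} <= n)%N -> (A \o B = B \o A)%VF ->
  exists2 q : {poly K}, (size q <= n)%N & A = lhorner q B.
Proof.
move=> li vn Bv dV AB; have [L LP] := lagrange li.
have Lv j k : lhorner (L j) B (v k) = (j == k)%:R *: v k.
  by rewrite (lhorner_eigen _ (Bv k)) (LP j).2.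
have indep (a : 'I_n -> K) : \sum_k a k *: v k = 0 -> forall j, a j = 0.
  move=> a0 j; have := congr1 (lhorner (L j) B) a0; rewrite linear0 linear_sum (bigD1 j) //=.
  rewrite big1 ?addr0 => [|k kj]; rewrite linearZ /= Lv.
    by rewrite eqxx scale1r => /eqP; rewrite scaler_eq0 (negbTE (vn j)) orbF => /eqP.
  by rewrite eq_sym (negbTE kj) scale0r scaler0.
pose X := [tuple v j | j < n].
have Xnth (j : 'I_n) : X`_j = v j by rewrite -tnth_nth tnth_mktuple.
have fX : free X.
  by apply/freeP => a; under eq_bigr => j _ do rewrite Xnth; exact: indep.
have bX : basis_of {:V} X by rewrite basisEfree fX subvf size_tuple.
have span w : w = \sum_j coord X j w *: v j.
  rewrite {1}(coord_basis bX (memvf w)); by under eq_bigr => j _ do rewrite Xnth.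
(* the eigenvalues of [A] on the eigenlines of [B] *)
pose b j := coord X j (A (v j)).
have bP j : A (v j) = b j *: v j.
  rewrite /b; set w := A (v j).
  have Bw : B w = l j *: w.
    by have /lfunP/(_ (v j)) := AB; rewrite !comp_lfunE Bv linearZ /= -/w => ->.
  have c0 k : k != j -> coord X k w = 0.
    move=> kj; have : \sum_i (coord X i w * (l i - l j)) *: v i = 0.
      under eq_bigr => i _ do rewrite mulrBr scalerBl.
      rewrite sumrB; apply/eqP; rewrite subr_eq0; apply/eqP.
      under [RHS]eq_bigr => i _ do rewrite mulrC -scalerA.
      rewrite -scaler_sumr -span -Bw {2}(span w) linear_sum; apply: eq_bigr => i _.
      by rewrite linearZ /= Bv scalerA.
    move/indep/(_ k)/eqP; rewrite mulf_eq0 subr_eq0 (inj_eq li) (negbTE kj) orbF => /eqP.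
    by [].
  rewrite {1}(span w) (bigD1 j) //= big1 ?addr0 // => k kj.
  by rewrite c0 // scale0r.
pose q := \sum_j b j *: L j.
have sq : (size q <= n)%N.
  apply: leq_trans (size_sum _ _ _) _; apply/bigmax_leqP => j _.
  exact: leq_trans (size_scale_leq _ _) (LP j).1.
exists q => //; apply/lfunP => w; rewrite (span w) !linear_sum; apply: eq_bigr => j _.
rewrite !linearZ /= bP (lhorner_eigen _ (Bv j)); congr (_ *: (_ *: _)).
rewrite /q horner_sum (bigD1 j) //= hornerZ (LP j).2 eqxx mulr1 big1 ?addr0 // => k kj.
by rewrite hornerZ (LP k).2 (negbTE kj) mulr0.
Qed.
End SimpleSpectrum.

(** * Ladder operators for so(3) *)

Section Ladder.
Variables (K : numFieldType) (V : vectType K) (d0 d1 d2 : 'End(V)) (ii : K).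
Hypothesis iiE : ii * ii = -1.
Hypothesis comm01 : forall w, d0 (d1 w) = d1 (d0 w) - d2 w.
Hypothesis comm12 : forall w, d1 (d2 w) = d2 (d1 w) - d0 w.
Hypothesis comm20 : forall w, d2 (d0 w) = d0 (d2 w) - d1 w.

Let coord_inj (w w' : V) : (forall k, coord (vbasis {:V}) k w = coord (vbasis {:V}) k w') -> w = w'.
Proof.
by move=> e; rewrite (coord_vbasis (memvf w)) (coord_vbasis (memvf w')); apply: eq_bigr => k _; rewrite e.
Qed.

(** With [d0], [d1], [d2] the images of the basis of so(3), these three are the usual
   Cartan element and the raising and lowering operators, [ii] being a square
   root of [-1]. *)
Definition weightH (w : V) : V := - ii *: d2 w.
Definition raiseE (w : V) : V := - ii *: d0 w + d1 w.
Definition lowerF (w : V) : V := - ii *: d0 w - d1 w.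

Lemma weight_lower w : weightH (lowerF w) = lowerF (weightH w) - lowerF w.
Proof.
have c1 : d2 (d1 w) = d1 (d2 w) + d0 w by rewrite comm12 subrK.
rewrite /weightH /lowerF linearB !linearZ /= c1 comm20.
rewrite !(scalerBr, scalerDr) !scalerA !mulrNN iiE.
rewrite !(scaleNr, scale1r) !opprK !opprD !opprK.
move: (d0 (d2 w)) (d1 (d2 w)) (d0 w) (d1 w) => x y z t.
by apply: coord_inj => k; rewrite !(linearD, linearN, linearZ) /=; ring.
Qed.

Lemma raise_lower w : raiseE (lowerF w) = lowerF (raiseE w) + 2 *: weightH w.
Proof.
rewrite /weightH /lowerF /raiseE !(linearB, linearD) !linearZ /= comm01.
rewrite !(scalerBr, scalerDr) !scalerA !mulrNN iiE.
by apply: coord_inj => k; rewrite !(linearD, linearN, linearZ) /=; ring.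
Qed.

(** The usual induction for a highest weight vector.  The factor
   [(j + 1) (2 m - j)] by which raising undoes lowering is nonzero for
   [j < 2 m], which is why lowering cannot produce zero before step [2 m + 1]. *)
Lemma ladder m (v : V) : v != 0 -> raiseE v = 0 -> weightH v = m%:R *: v ->
  forall j, (j <= m.*2)%N -> [/\ iter j lowerF v != 0, 
    weightH (iter j lowerF v) = (m%:R - j%:R) *: iter j lowerF v &
    raiseE (iter j.+1 lowerF v) = (j.+1%:R * (m.*2%:R - j%:R)) *: iter j lowerF v].
Proof.
move=> v0 Ev Hv.
have lowerZ a w : lowerF (a *: w) = a *: lowerF w.
  by rewrite /lowerF; apply: coord_inj => k; rewrite !(linearD, linearN, linearZ) /=; ring.
have lower0 : lowerF 0 = 0 by rewrite /lowerF !linear0 ?addr0.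
elim=> [_|j IH jm]; first split=> //.
- by rewrite mulr0n subr0.
- by rewrite /= raise_lower Ev lower0 add0r Hv scalerA mulr0n subr0 mul1r -muln2 natrM mulrC.
have [n0 H1 E1] := IH (ltnW jm).
have nz : iter j.+1 lowerF v != 0.
  apply/eqP => z; move: E1; rewrite z /raiseE !linear0 ?addr0 => /esym/eqP.
  rewrite scaler_eq0 (negbTE n0) orbF mulf_eq0 pnatr_eq0 /= subr_eq0 eqr_nat => /eqP e.
  by rewrite -e ltnn in jm.
have H2 : weightH (iter j.+1 lowerF v) = (m%:R - j.+1%:R) *: iter j.+1 lowerF v.
  rewrite iterS weight_lower H1 lowerZ -{2}[lowerF _]scale1r -scalerBl; congr (_ *: _).
  by rewrite -[in RHS]addn1 natrD opprD addrA.
split=> //; rewrite [iter _.+2 _ _]iterS raise_lower E1 lowerZ H2 scalerA -iterS -scalerDl.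
congr (_ *: _); rewrite -[m.*2]muln2 natrM -[j.+2]addn1 -[j.+1]addn1 !natrD; ring.
Qed.
End Ladder.

Import numFieldNormedType.Exports.
Local Open Scope classical_set_scope.
Local Open Scope complex_scope.

(** * Symmetry of second derivatives *)

Lemma is_derive_line (R : realType) (E : normedModType R) (g : E -> R) (x v : E) (s : R) :
  derivable g (x + s *: v) v ->
  is_derive s 1 (fun t : R => g (x + t *: v)) ('D_v g (x + s *: v)).
Proof.
have e : (fun h : R => h^-1 *: (((fun t : R => g (x + t *: v)) \o shift s) (h *: 1) - g (x + s *: v)))
   = (fun h : R => h^-1 *: ((g \o shift (x + s *: v)) (h *: v) - g (x + s *: v))).
  apply/funext => h /=; congr (_ *: (g _ - _)).
  have -> : h *: (1 : R) = h by exact: mulr1.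
  by rewrite scalerDl addrCA.
by move=> dg; apply: DeriveDef; rewrite /derivable /derive /= e.
Qed.

(** The mean value theorem is applied first in the direction [v], to
   [s |-> g (x + h w + s v) - g (x + s v)], and then in the direction [w]. *)
Lemma second_difference (R : realType) (E : normedModType R) (g : E -> R) (x v w : E) (h : R) :
  0 < h -> (forall y, differentiable g y) ->
  (forall y, differentiable (fun z => 'D_v g z) y) ->
  exists c d : R, [/\ 0 <= c <= h, 0 <= d <= h &
    g (x + h *: v + h *: w) - g (x + h *: v) - g (x + h *: w) + g x =
    h ^+ 2 * 'D_w (fun z => 'D_v g z) (x + c *: v + d *: w)].
Proof.
move=> h0 gd gvd.
pose phi (s : R) := g (x + h *: w + s *: v) - g (x + s *: v).
have dphi (s : R) : is_derive s 1 phi ('D_v g (x + h *: w + s *: v) - 'D_v g (x + s *: v)).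
  by apply: is_deriveB; apply: is_derive_line; exact: diff_derivable.
have [|c cI phiE] := @MVT_segment _ phi _ _ _ (ltW h0) (fun s _ => dphi s).
  by apply: derivable_within_continuous => s _; have [] := dphi s.
have dpsi (t : R) := is_derive_line (diff_derivable (v := w) (gvd (x + c *: v + t *: w))).
have [|d dI psiE] := @MVT_segment _ (fun t => 'D_v g (x + c *: v + t *: w)) _ _ _ (ltW h0) (fun t _ => dpsi t).
  by apply: derivable_within_continuous => t _; have [] := dpsi t.
exists c, d; split; [by move: cI; rewrite in_itv | by move: dI; rewrite in_itv |].
rewrite expr2 -mulrA mulrCA mulrC.
have -> : h * 'D_w (fun z => 'D_v g z) (x + c *: v + d *: w) =
   'D_v g (x + c *: v + h *: w) - 'D_v g (x + c *: v + 0 *: w).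
  by rewrite psiE subr0 mulrC.
move: phiE; rewrite /phi subr0 !scale0r !addr0 (addrAC x (c *: v)) (addrAC x (h *: v)) => <-.
ring.
Qed.

(** The second difference of [g] is symmetric in [v] and [w], so both mixed
   derivatives take the same value at points arbitrarily close to [x]. *)
Lemma schwarz (R : realType) (E : normedModType R) (g : E -> R) (x v w : E) :
  (forall y, differentiable g y) ->
  (forall y, differentiable (fun z => 'D_v g z) y) ->
  (forall y, differentiable (fun z => 'D_w g z) y) ->
  {for x, continuous (fun y => 'D_w (fun z => 'D_v g z) y)} ->
  {for x, continuous (fun y => 'D_v (fun z => 'D_w g z) y)} ->
  'D_w (fun z => 'D_v g z) x = 'D_v (fun z => 'D_w g z) x.
Proof.
move=> gd gv gw cF cG.
set F := fun y => 'D_w (fun z => 'D_v g z) y in cF *.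
set G := fun y => 'D_v (fun z => 'D_w g z) y in cG *.
apply/eqP; rewrite -/(F x) -/(G x) -subr_eq0 -normr_le0.
apply/ler_addgt0Pl => e e0; rewrite addr0.
have e20 : 0 < e / 2 by rewrite divr_gt0.
have nF : \forall y \near x, `|F x - F y| < e / 2 by move/cvgrPdist_lt: cF; apply.
have nG : \forall y \near x, `|G x - G y| < e / 2 by move/cvgrPdist_lt: cG; apply.
have [d d0 dP] := (nbhs_ballP _ _).1 (filterI nF nG).
pose N := `|v| + `|w| + 1.
have N0 : 0 < N by rewrite ltr_wpDl // addr_ge0.
(* small enough for [h |v| + h |w| < d] *)
pose h := d / N / 2.
have h0 : 0 < h by rewrite !divr_gt0.
have inball a b : 0 <= a <= h -> 0 <= b <= h -> ball x d (x + a *: v + b *: w).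
  move=> /andP[a0 ah] /andP[b0 bh]; rewrite -ball_normE /ball_ /= -addrA opprD addNKr normrN.
  apply: (le_lt_trans (ler_normD _ _)); rewrite !normrZ !ger0_norm //.
  apply: (@le_lt_trans _ _ (h * N)).
    by rewrite /N !mulrDr mulr1 -[leLHS]addr0 !lerD ?ler_wpM2r // ltW.
  have -> : h * N = d / 2 by rewrite /h; field; rewrite gt_eqF.
  by rewrite ltr_pdivrMr // ltr_pMr // ltr1n.
have [a [b [aI bI eF]]] := second_difference x w h0 gd gv.
have [a' [b' [aI' bI' eG]]] := second_difference x v h0 gd gw.
have eFG : F (x + a *: v + b *: w) = G (x + a' *: w + b' *: v).
  apply: (mulfI (lt0r_neq0 (exprn_gt0 2 h0))); apply: etrans (esym eF) (etrans _ eG).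
  by rewrite [in RHS](addrAC x); ring.
clear eF eG; clearbody F G.
have [Fy _] := dP _ (inball _ _ aI bI).
have [_ Gy] := dP _ (inball _ _ bI' aI').
apply: le_trans (ler_distD (F (x + a *: v + b *: w)) _ _) _.
by rewrite [e]splitr lerD ?(ltW Fy) // eFG addrAC distrC ltW.
Qed.

Section PartialsCommute.
Variables (R : realType) (V : vectType R[i]).
Local Notation R3 := 'cV[R]_3.

Lemma partial_comm i j (u : R3 -> V) :
  smooth u -> partial i (partial j u) = partial j (partial i u).
Proof.
move=> su; apply/funext => x; apply: vcoordP => k.
have derE l (w : R3 -> V) y : vcoord k (partial l w y) = cderive (vcoord k \o w) y (delta_mx l 0).
  exact (vcoord_vderive w y (delta_mx l 0) k).
have coordE l (w : R3 -> V) : vcoord k \o partial l w = fun y => cderive (vcoord k \o w) y (delta_mx l 0).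
  by apply/funext => y; exact: derE.
have d0 y := (su 1%N).1 y k.
have d1 l y : cdifferentiable (vcoord k \o partial l u) y := (smooth_partial l su 1%N).1 y k.
have d2 l l' y : cdifferentiable (vcoord k \o partial l' (partial l u)) y :=
  (smooth_partial l' (smooth_partial l su) 1%N).1 y k.
rewrite [LHS]derE [RHS]derE [in LHS]coordE [in RHS]coordE /cderive /=; apply: (congr2 (@Complex R)).
- apply: schwarz => [y|y|y||].
  + exact: (d0 y).1.
  + by have := (d1 j y).1; rewrite coordE.
  + by have := (d1 i y).1; rewrite coordE.
  + by have := (d2 j i x).1; rewrite coordE (coordE j); exact: differentiable_continuous.
  + by have := (d2 i j x).1; rewrite coordE (coordE i); exact: differentiable_continuous.
- apply: schwarz => [y|y|y||].
  + exact: (d0 y).2.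
  + by have := (d1 j y).2; rewrite coordE.
  + by have := (d1 i y).2; rewrite coordE.
  + by have := (d2 j i x).2; rewrite coordE (coordE j); exact: differentiable_continuous.
  + by have := (d2 i j x).2; rewrite coordE (coordE i); exact: differentiable_continuous.
Qed.

Lemma partial_op_comm i j (u : smoothfun V) :
  partial_op i (partial_op j u) = partial_op j (partial_op i u).
Proof. by apply/val_inj/partial_comm/smoothfunP. Qed.

Lemma partial_op_is_linear i : linear (@partial_op R V i).
Proof.
move=> a u w; apply/val_inj/funext => x.
exact: (vdiffP a (delta_mx i 0) ((smoothfunP u 1%N).1 x) ((smoothfunP w 1%N).1 x)).2.
Qed.
HB.instance Definition _ i := GRing.isLinear.Build R[i] (smoothfun V) (smoothfun V) _
  (@partial_op R V i) (partial_op_is_linear i).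
End PartialsCommute.

Section Postcomp.
Variables (R : realType).
Implicit Types V W : vectType R[i].

Lemma postcomp_opE V W (A : {linear V -> W}) u x : postcomp_op A u x = A (u x).
Proof. by []. Qed.

Lemma smoothfun_ext V (u w : smoothfun V) : u =1 w -> u = w.
Proof. by move=> uw; apply/val_inj/funext. Qed.

Lemma smoothfunD V (u w : smoothfun V) x : (u + w) x = u x + w x.
Proof. by []. Qed.
Lemma smoothfunZ V a (u : smoothfun V) x : (a *: u) x = a *: u x.
Proof. by []. Qed.
Lemma smoothfun_sum V (I : Type) (s : seq I) (u : I -> smoothfun V) x :
  (\sum_(i <- s) u i) x = \sum_(i <- s) u i x.
Proof. by elim: s => [|i s IH]; rewrite ?big_nil ?big_cons // -IH. Qed.

Lemma postcomp_op_is_linear V W (A : {linear V -> W}) : linear (postcomp_op A).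
Proof. by move=> a u w; apply/val_inj/funext => x /=; rewrite linearP. Qed.
HB.instance Definition _ V W (A : {linear V -> W}) :=
  GRing.isLinear.Build R[i] (smoothfun V) (smoothfun W) _ (postcomp_op A) (postcomp_op_is_linear A).

Lemma partial_postcomp V W (A : {linear V -> W}) i u :
  partial_op i (postcomp_op A u) = postcomp_op A (partial_op i u).
Proof. by apply/val_inj/funext => x; exact: (vdiff_lin _ _ ((smoothfunP u 1%N).1 x)).2. Qed.
End Postcomp.

(** * Polynomials determined by their values *)

Lemma poly_nat_eq0 (K : numDomainType) (p : {poly K}) :
  (forall k : nat, p.[k%:R] = 0) -> p = 0.
Proof.
move=> p0; apply/eqP/negPn/negP => nz.
have := max_poly_roots nz (rs := [seq k%:R | k <- iota 0 (size p)]).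
rewrite size_map size_iota ltnn => H; suff: false by []; apply: H.
  by apply/allP => _ /mapP[k _ ->]; apply/rootP.
rewrite map_inj_uniq ?iota_uniq // => k l /eqP.
by rewrite eqr_nat => /eqP.
Qed.

(** Uniqueness of the digits of a number in base [N]. *)
Lemma digits_inj N n (a b : 'I_n -> nat) :
  (forall i, (a i < N)%N) -> (forall i, (b i < N)%N) ->
  (\sum_(i < n) a i * N ^ i = \sum_(i < n) b i * N ^ i)%N -> a =1 b.
Proof.
elim: n a b => [|n IH] a b aN bN; first by move=> _ [].
have split (c : 'I_n.+1 -> nat) :
    (\sum_(i < n.+1) c i * N ^ i = (\sum_(i < n) c (lift ord0 i) * N ^ i) * N + c ord0)%N.
  rewrite big_ord_recl muln1 addnC big_distrl; congr (_ + _)%N.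
  by apply: eq_bigr => i _; rewrite /= -mulnA -expnSr.
have N0 : (0 < N)%N by exact: leq_ltn_trans (leq0n _) (aN ord0).
rewrite !split => e.
have e0 : a ord0 = b ord0.
  by have := congr1 (modn^~ N) e; rewrite !modnMDl !modn_small.
move: e; rewrite e0 => /addIn /eqP; rewrite eqn_pmul2r // => /eqP /IH H i.
by have [j ->|->] := unliftP ord0 i; first exact: H.
Qed.

(** Kronecker substitution: at [x_i = t ^ (N ^ i)], with [N] larger than all
   exponents, distinct monomials become distinct powers of [t], so that the
   coefficients are those of a univariate polynomial in [t]. *)
Lemma mpoly_nat_eq0 (K : numDomainType) n (p : mpoly n K) :
  (forall x : 'I_n -> nat, meval (fun i => (x i)%:R) p = 0) -> p = 0.
Proof.
move=> p0; pose N := msize p.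
pose kr (a : multinom n) := (\sum_(i < n) a i * N ^ i)%N.
have suppN a : a \in msupp p -> forall i, (a i < N)%N.
  move=> ap i; apply: (leq_ltn_trans _ (msize_mdeg_lt ap)).
  by rewrite mdegE (bigD1 i) //= leq_addr.
(* the univariate polynomial obtained by the substitution *)
pose P : {poly K} := \sum_(a <- msupp p) mcoeff a p *: 'X^(kr a).
have P0 : P = 0.
  apply: poly_nat_eq0 => t; rewrite -[RHS](p0 (fun i => (t ^ (N ^ i))%N)) mevalE horner_sum.
  apply: eq_bigr => a _; rewrite hornerZ hornerXn; congr (_ * _).
  rewrite /kr -prodrXr; apply: eq_bigr => i _.
  by rewrite natrX -exprM mulnC.
apply/mpolyP => a; rewrite mcoeff0.
have [ap|/memN_msupp_eq0//] := boolP (a \in msupp p).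
have := congr1 (fun q : {poly K} => q`_(kr a)) P0; rewrite coef0 coef_sum => <-.
rewrite (bigD1_seq a) ?msupp_uniq //= coefZ coefXn eqxx mulr1.
rewrite big_seq_cond big1 ?addr0 // => b /andP[bp ba].
rewrite coefZ coefXn; case: eqP => [e|_]; last by rewrite mulr0.
by case/negP: ba; apply/eqP/mnmP => i; rewrite (digits_inj (suppN _ ap) (suppN _ bp) e).
Qed.

Lemma mpoly_real_inj (R : realType) n (p q : mpoly n R[i]) :
  (forall x : 'I_n -> R, meval (fun i => (x i)%:C) p = meval (fun i => (x i)%:C) q) -> p = q.
Proof.
move=> pq; apply/eqP; rewrite -subr_eq0; apply/eqP/mpoly_nat_eq0 => x.
rewrite mevalB -[X in X - _](@meval_eq _ _ (fun i => ((x i)%:R : R)%:C)) => [|i]; last by rewrite rmorph_nat.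
rewrite -[X in _ - X](@meval_eq _ _ (fun i => ((x i)%:R : R)%:C)) => [|i]; last by rewrite rmorph_nat.
by rewrite pq subrr.
Qed.

(** * Symbol calculus of constant coefficient operators *)

Section SymbolCalculus.
Variables (R : realType) (V : vectType R[i]).
Local Notation C := R[i].
Local Notation poly3 := (mpoly 3 C).
Local Notation op := (smoothfun V -> smoothfun V).
Implicit Types (u : smoothfun V) (p q : poly3) (s : seq (poly3 * 'End(V))).

Definition monomial_op (a : multinom 3) u : smoothfun V :=
  iter (a 0) (partial_op 0) (iter (a 1) (partial_op 1) (iter (a 2) (partial_op 2) u)).

Lemma iter_partial_comm i j k l u :
  iter k (partial_op i) (iter l (partial_op j) u) = iter l (partial_op j) (iter k (partial_op i) u).
Proof.
have E : partial_op i (iter l (partial_op j) u) = iter l (partial_op j) (partial_op i u).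
  by elim: l => //= l IH; rewrite partial_op_comm IH.
elim: k => //= k ->; elim: l {E} => //= l IH.
by rewrite partial_op_comm IH.
Qed.

Lemma monomial_opD a b u : monomial_op (mnm_add a b) u = monomial_op a (monomial_op b u).
Proof.
rewrite /monomial_op !mnmDE !iterD; congr iter.
by rewrite [in RHS](iter_partial_comm 2 0) [in RHS](iter_partial_comm 1 0)
  [in RHS](iter_partial_comm 2 1).
Qed.

Lemma monomial_op_is_linear a : linear (monomial_op a).
Proof.
have itl i k : linear (iter k (@partial_op R V i)).
  by elim: k => [|k IH] x u w //=; rewrite IH linearP.
by move=> x u w; rewrite /monomial_op !itl.
Qed.
HB.instance Definition _ a :=
  GRing.isLinear.Build C (smoothfun V) (smoothfun V) _ (monomial_op a) (monomial_op_is_linear a).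

Lemma scalar_diffopE k p u : (msize p <= k)%N ->
  scalar_diffop p u = \sum_(a : bmultinom 3 k) mcoeff a p *: monomial_op a u.
Proof.
move=> pk; rewrite -[LHS]/(\sum_(a <- msupp p) mcoeff a p *: monomial_op a u).
set I : subFinType _ := bmultinom 3 k.
rewrite (big_mksub I) //=; first last.
- by move=> x /msize_mdeg_lt/leq_trans; apply.
- by rewrite msupp_uniq.
by rewrite big_rmcond //= => i; move/memN_msupp_eq0 ->; rewrite scale0r.
Qed.

Lemma scalar_diffop_linear u : linear ((@scalar_diffop R V)^~ u).
Proof.
move=> c p q /=; pose k := maxn (msize (c *: p + q)) (maxn (msize p) (msize q)).
rewrite !(@scalar_diffopE k) ?leq_max ?leqnn ?orbT //.
rewrite scaler_sumr -big_split; apply: eq_bigr => a _ /=.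
by rewrite mcoeffD mcoeffZ scalerDl scalerA.
Qed.

Lemma scalar_diffop_is_linear p : linear (@scalar_diffop R V p).
Proof.
move=> c u w; rewrite /scalar_diffop scaler_sumr -big_split; apply: eq_bigr => a _ /=.
by rewrite -!/(monomial_op _ _) linearP scalerDr !scalerA mulrC.
Qed.
HB.instance Definition _ p := GRing.isLinear.Build C (smoothfun V) (smoothfun V) _
  (@scalar_diffop R V p) (scalar_diffop_is_linear p).

Lemma scalar_diffopX a u : scalar_diffop (mpolyX C a) u = monomial_op a u.
Proof. by rewrite /scalar_diffop msuppX big_seq1 mcoeffX eqxx scale1r. Qed.

Lemma scalar_diffopD p q u : scalar_diffop (p + q) u = scalar_diffop p u + scalar_diffop q u.
Proof. by have := scalar_diffop_linear u 1 p q; rewrite !scale1r. Qed.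
Lemma scalar_diffop0 u : scalar_diffop 0 u = 0.
Proof. by rewrite /scalar_diffop msupp0 big_nil. Qed.
Lemma scalar_diffopZ c p u : scalar_diffop (c *: p) u = c *: scalar_diffop p u.
Proof. by have := scalar_diffop_linear u c p 0; rewrite scalar_diffop0 !addr0. Qed.
Lemma scalar_diffop_sum (I : Type) (r : seq I) (p : I -> poly3) u :
  scalar_diffop (\sum_(i <- r) p i) u = \sum_(i <- r) scalar_diffop (p i) u.
Proof.
elim: r => [|i r IH]; first by rewrite !big_nil scalar_diffop0.
by rewrite !big_cons scalar_diffopD IH.
Qed.

(** Reduces to monomials, where it is the commutation of partial derivatives. *)
Lemma scalar_diffopM p q u : scalar_diffop (p * q) u = scalar_diffop p (scalar_diffop q u).
Proof.
elim/mpolyind: p => [|c a p _ _ IH]; first by rewrite mul0r !scalar_diffop0.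
rewrite mulrDl -scalerAl !(scalar_diffopD, scalar_diffopZ) IH; congr (_ *: _ + _).
elim/mpolyind: q {IH} => [|d b q _ _ IH]; first by rewrite mulr0 !scalar_diffop0 linear0.
rewrite mulrDr -scalerAr !(scalar_diffopD, scalar_diffopZ) IH linearP /=; congr (_ *: _ + _).
by rewrite -mpolyXD !scalar_diffopX monomial_opD.
Qed.

Lemma scalar_diffop_postcomp p (A : {linear V -> V}) u :
  scalar_diffop p (postcomp_op A u) = postcomp_op A (scalar_diffop p u).
Proof.
rewrite /scalar_diffop linear_sum; apply: eq_bigr => a _.
have E i k w : iter k (partial_op i) (postcomp_op A w) = postcomp_op A (iter k (partial_op i) w).
  by elim: k => //= k ->; rewrite partial_postcomp.
by rewrite !E linearZ.
Qed.

(** The operator of an element of the tensor product, given as a list of pure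
   tensors; several lists represent the same element. *)
Definition tensor_op s : op := fun u => \sum_(t <- s) postcomp_op t.2 (scalar_diffop t.1 u).
Definition symbol s (x : 'I_3 -> C) : 'End(V) := \sum_(t <- s) meval x t.1 *: t.2.

(** Collecting the terms along a basis of [End(V)] gives a representation by
   coordinate polynomials, which no longer depends on the list. *)
Lemma tensor_op_coord s u : tensor_op s u =
  \sum_(k < \dim {:'End(V)}) postcomp_op (vbasis {:'End(V)})`_k
     (scalar_diffop (\sum_(t <- s) vcoord k t.2 *: t.1) u).
Proof.
apply: smoothfun_ext => x; rewrite /tensor_op !smoothfun_sum.
under [RHS]eq_bigr => k _.
  rewrite postcomp_opE scalar_diffop_sum smoothfun_sum linear_sum.
  under eq_bigr => t _ do rewrite scalar_diffopZ smoothfunZ linearZ.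
  over.
rewrite exchange_big; apply: eq_bigr => t _ /=.
rewrite {1}(coord_vbasis (memvf t.2)) sum_lfunE.
by apply: eq_bigr => k _; rewrite scale_lfunE.
Qed.

Lemma symbol_coord s x k : vcoord k (symbol s x) = meval x (\sum_(t <- s) vcoord k t.2 *: t.1).
Proof.
rewrite /vcoord /symbol !raddf_sum /=; apply: eq_bigr => t _.
by rewrite linearZ mevalZ mulrC.
Qed.
End SymbolCalculus.

(** * Exponentials as test functions *)

Section Exponentials.
Variables (R : realType) (V : vectType R[i]).
Local Notation C := R[i].
Local Notation R3 := 'cV[R]_3.
Implicit Types (xi x : R3) (w : V).

Definition dotp xi x : R := \sum_(i < 3) xi i 0 * x i 0.

Lemma dotp_is_linear xi : linear (dotp xi).
Proof.
move=> a x y; rewrite /dotp scaler_sumr -big_split; apply: eq_bigr => i _ /=.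
by rewrite !mxE mulrDr mulrCA.
Qed.
HB.instance Definition _ xi := GRing.isLinear.Build R R3 R _ (dotp xi) (dotp_is_linear xi).

Lemma dotp_delta xi i : dotp xi (delta_mx i 0) = xi i 0.
Proof.
rewrite /dotp (bigD1 i) //= mxE !eqxx mulr1 big1 ?addr0 // => j ne.
by rewrite mxE (negbTE ne) mulr0.
Qed.

Lemma dotp_continuous xi : continuous (dotp xi : R3 -> R).
Proof.
have -> : (dotp xi : R3 -> R) = \sum_(j < 3) (xi j 0 *: (fun x : R3 => x j 0)).
  by apply/funext => x; rewrite fct_sumE.
move=> x; apply/differentiable_continuous/differentiable_sum => j.
exact/differentiableZ/differentiable_coord.
Qed.

Lemma derive_exp xi x v :
  differentiable (fun y : R3 => expR (dotp xi y)) x /\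
  'D_v (fun y : R3 => expR (dotp xi y)) x = expR (dotp xi x) * dotp xi v.
Proof.
have ld : differentiable (dotp xi : R3 -> R) x.
  by apply: linear_differentiable; exact: dotp_continuous.
have ed : differentiable (@expR R) (dotp xi x).
  by apply/derivable1_diffP; exact: derivable_expR.
split; first exact: (differentiable_comp ld ed).
rewrite deriveE; last exact: (differentiable_comp ld ed).
rewrite (diff_comp ld ed) /= diff_lin; last exact: dotp_continuous.
rewrite deriv1E; last exact: derivable_expR.
have ev : 'D_1 (@expR R) (dotp xi x) = expR (dotp xi x) by rewrite derive_val.
by rewrite derive1E; apply: etrans (congr1 ( *:%R _) ev) _; rewrite [LHS]mulrC.
Qed.

Definition expfct xi w : R3 -> V := fun x => (expR (dotp xi x))%:C *: w.

Lemma expfct_diff xi w x v : vdifferentiable (expfct xi w) x /\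
  vderive (expfct xi w) x v = (dotp xi v)%:C *: expfct xi w x.
Proof.
have E k : vcoord k \o expfct xi w = fun y => (expR (dotp xi y))%:C * vcoord k w.
  by apply/funext => y; rewrite /= /expfct /vcoord linearZ.
have ReE (c : C) (r : R) : complex.Re (r%:C * c) = complex.Re c *: r.
  by case: c => a b; rewrite /= mul0r subr0 [RHS]mulrC.
have ImE (c : C) (r : R) : complex.Im (r%:C * c) = complex.Im c *: r.
  by case: c => a b; rewrite /= mul0r addr0 [RHS]mulrC.
have [ed ev] := derive_exp xi x v.
have dd : derivable (fun y : R3 => expR (dotp xi y)) x v by exact: diff_derivable.
split=> [k|].
  rewrite E; split.
    rewrite [X in differentiable X _](_ : _ = complex.Re (vcoord k w) *: (fun y : R3 => expR (dotp xi y))).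
      exact: differentiableZ.
    by apply/funext => y; rewrite ReE.
  rewrite [X in differentiable X _](_ : _ = complex.Im (vcoord k w) *: (fun y : R3 => expR (dotp xi y))).
    exact: differentiableZ.
  by apply/funext => y; rewrite ImE.
apply: vcoordP => k; rewrite vcoord_vderive E /cderive.
rewrite [X in 'D_v X x +i* _](_ : _ = complex.Re (vcoord k w) *: (fun y : R3 => expR (dotp xi y))); last first.
  by apply/funext => y; rewrite ReE.
rewrite [X in _ +i* 'D_v X x](_ : _ = complex.Im (vcoord k w) *: (fun y : R3 => expR (dotp xi y))); last first.
  by apply/funext => y; rewrite ImE.
rewrite !deriveZ // ev /vcoord !linearZ /= -/(vcoord k w).
case: (vcoord k w) => a b; apply/eqP; rewrite eq_complex /= !mul0r !subr0 !addr0 /GRing.scale /=.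
by apply/andP; split; apply/eqP; ring.
Qed.

Lemma expfct_partial xi w i : partial i (expfct xi w) = expfct xi ((xi i 0)%:C *: w).
Proof.
apply/funext => x; rewrite /partial (expfct_diff xi w x _).2 dotp_delta.
by rewrite /expfct !scalerA mulrC.
Qed.

Lemma expfct_smooth xi w : smooth (expfct xi w).
Proof.
move=> n; elim: n w => //= n IH w; split=> [x|i]; first exact: (expfct_diff xi w x 0).1.
by rewrite expfct_partial.
Qed.

Definition expfun xi w : smoothfun V := smoothOf (expfct_smooth xi w).

Lemma expfun_partial xi w i : partial_op i (expfun xi w) = expfun xi ((xi i 0)%:C *: w).
Proof. by apply: smoothfun_ext => x /=; rewrite expfct_partial. Qed.

Definition realpt xi : 'I_3 -> C := fun i => (xi i 0)%:C.

(** An exponential is a joint eigenfunction of all partial derivatives. *)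
Lemma scalar_diffop_exp p xi w :
  scalar_diffop p (expfun xi w) = expfun xi (meval (realpt xi) p *: w).
Proof.
have expL a w1 w2 : expfun xi (a *: w1 + w2) = a *: expfun xi w1 + expfun xi w2.
  apply: smoothfun_ext => x; rewrite smoothfunD smoothfunZ /= /expfct.
  by rewrite scalerDr !scalerA mulrC.
have exp0 : expfun xi 0 = 0.
  by apply: smoothfun_ext => x /=; rewrite /expfct scaler0.
elim/mpolyind: p => [|c a p _ _ IH]; first by rewrite scalar_diffop0 meval0 scale0r exp0.
rewrite scalar_diffopD scalar_diffopZ IH mevalD mevalZ scalerDl -scalerA expL; congr (_ *: _ + _).
rewrite scalar_diffopX mevalX /monomial_op.
have it i k w' : iter k (partial_op i) (expfun xi w') = expfun xi (realpt xi i ^+ k *: w').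
  elim: k => [|k IHk]; first by rewrite scale1r.
  by rewrite iterS IHk expfun_partial scalerA -exprS.
rewrite !it !scalerA; congr (expfun xi (_ *: _)).
rewrite !big_ord_recl big_ord0 mulr1 -!mulrA.
by congr (_ ^+ _ * (_ ^+ _ * _ ^+ _)); try congr (realpt xi _); try congr (a _); apply/val_inj.
Qed.

Lemma tensor_op_exp s xi w x :
  tensor_op s (expfun xi w) x = (expR (dotp xi x))%:C *: symbol s (realpt xi) w.
Proof.
rewrite /tensor_op smoothfun_sum /symbol sum_lfunE scaler_sumr; apply: eq_bigr => t _.
rewrite postcomp_opE scalar_diffop_exp /= /expfct linearZ scale_lfunE.
by rewrite linearZ.
Qed.

End Exponentials.

(** * Operators and their symbols *)

Section HasSymbol.
Variables (R : realType) (V : vectType R[i]).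
Local Notation C := R[i].
Local Notation R3 := 'cV[R]_3.
Local Notation op := (smoothfun V -> smoothfun V).
Implicit Types (P Q : op) (f g : ('I_3 -> C) -> 'End(V)).

(** The symbol is kept as a function on complex covectors, so that equality of
   symbols can be tested at real points and used at isotropic ones. *)
Definition has_symbol P f := exists2 s, P = tensor_op s & f =1 symbol s.

Lemma diffop_symbol P : diffop P -> exists f, has_symbol P f.
Proof. by move=> [s ->]; exists (symbol s); exists s. Qed.

Lemma has_symbol_diffop P f : has_symbol P f -> diffop P.
Proof. by move=> [s -> _]; exists s. Qed.

Lemma has_symbol_ext P f g : f =1 g -> has_symbol P f -> has_symbol P g.
Proof. by move=> fg [s Ps fs]; exists s => // x; rewrite -fg. Qed.

Lemma has_symbol_exp P f xi w x : has_symbol P f ->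
  P (expfun xi w) x = (expR (dotp xi x))%:C *: f (realpt xi) w.
Proof. by move=> [s -> ->]; exact: tensor_op_exp. Qed.

(** The coordinates of a symbol are polynomials, and polynomials that agree on
   real points are equal. *)
Lemma symbol_inj P Q f g : has_symbol P f -> has_symbol Q g ->
  (forall xi : R3, f (realpt xi) = g (realpt xi)) -> P = Q /\ f =1 g.
Proof.
move=> [s -> fs] [t -> gt] fg.
have st k : \sum_(c <- s) vcoord k c.2 *: c.1 = \sum_(c <- t) vcoord k c.2 *: c.1.
  apply: mpoly_real_inj => x; rewrite -!symbol_coord -fs -gt.
  have -> : (fun i => (x i)%:C) = realpt (\col_i x i) by apply/funext => i; rewrite /realpt mxE.
  by rewrite fg.
split; first by apply/funext => u; rewrite !tensor_op_coord; apply: eq_bigr => k _; rewrite st.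
by move=> x; rewrite fs gt; apply: vcoordP => k; rewrite !symbol_coord st.
Qed.

Lemma has_symbol_id : has_symbol id (fun _ => \1%VF).
Proof.
exists [:: (1, \1%VF)] => [|x]; last by rewrite /symbol big_seq1 meval1 scale1r.
apply/funext => u; rewrite /tensor_op big_seq1; apply: smoothfun_ext => x /=.
by rewrite id_lfunE -mpolyX0 scalar_diffopX /monomial_op !mnm0E.
Qed.

Lemma has_symbol0 : has_symbol 0 (fun _ => 0).
Proof.
exists [::] => [|x]; last by rewrite /symbol big_nil.
by apply/funext => u; rewrite /tensor_op big_nil.
Qed.

Lemma has_symbolD P Q f g : has_symbol P f -> has_symbol Q g ->
  has_symbol (P + Q) (fun x => f x + g x).
Proof.
move=> [s -> fs] [t -> gt]; exists (s ++ t) => [|x]; last by rewrite /symbol big_cat fs gt.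
by apply/funext => u; rewrite /tensor_op big_cat.
Qed.

Lemma has_symbol_sum (I : Type) (r : seq I) (P : I -> op) (f : I -> ('I_3 -> C) -> 'End(V)) :
  (forall i, has_symbol (P i) (f i)) ->
  has_symbol (\sum_(i <- r) P i) (fun x => \sum_(i <- r) f i x).
Proof.
move=> Pf; elim: r => [|i r IH].
  by rewrite big_nil; apply: has_symbol_ext has_symbol0 => x; rewrite big_nil.
by rewrite big_cons; apply: has_symbol_ext (has_symbolD (Pf i) IH) => x; rewrite big_cons.
Qed.

Lemma has_symbol_comp P Q f g : has_symbol P f -> has_symbol Q g ->
  has_symbol (P \o Q) (fun x => (f x \o g x)%VF).
Proof.
move=> [s -> fs] [t -> gt].
exists [seq (c.1 * d.1, (c.2 \o d.2)%VF) | c <- s, d <- t] => [|x].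
  apply/funext => u; rewrite /tensor_op big_allpairs_dep /=; apply: eq_bigr => c _.
  rewrite [scalar_diffop c.1 _]linear_sum linear_sum; apply: eq_bigr => d _ /=.
  rewrite scalar_diffop_postcomp scalar_diffopM; apply: smoothfun_ext => x /=.
  by rewrite comp_lfunE.
rewrite fs gt /symbol big_allpairs_dep /=; apply/lfunP => w.
rewrite comp_lfunE !sum_lfunE; apply: eq_bigr => c _; rewrite linear_sum sum_lfunE.
apply: eq_bigr => d _; rewrite mevalM !scale_lfunE comp_lfunE /= linearZ.
by rewrite /= scale_lfunE scalerA mulrC.
Qed.

Lemma has_symbolZ (a : C) P f : has_symbol P f -> has_symbol (a *: P) (fun x => a *: f x).
Proof.
move=> [s -> fs]; exists [seq (a *: c.1, c.2) | c <- s] => [|x].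
  apply/funext => u; rewrite /tensor_op big_map /= -[LHS]/(a *: \sum_(_ <- s) _) scaler_sumr.
  by apply: eq_bigr => c _; rewrite scalar_diffopZ linearZ.
rewrite fs /symbol big_map scaler_sumr; apply: eq_bigr => c _.
by rewrite mevalZ scalerA.
Qed.

Lemma has_symbol_partial i (A : 'End(V)) :
  has_symbol (fun u => partial_op i (postcomp_op A u)) (fun x => x i *: A).
Proof.
exists [:: (mpolyX C (mnm1 i), A)] => [|x]; last by rewrite /symbol big_seq1 mevalXU.
apply/funext => u; rewrite /tensor_op big_seq1 /= partial_postcomp scalar_diffopX.
congr (postcomp_op A _); rewrite /monomial_op !mnm1E.
case: i => [[|[|[|//]]] lt]; by congr (partial_op _ u); apply/val_inj.
Qed.

Lemma has_symbol_laplacian :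
  has_symbol (@laplacian R V) (fun x => (\sum_i x i ^+ 2) *: \1%VF).
Proof.
have H i : has_symbol (partial_op i \o partial_op i) (fun x => x i ^+ 2 *: (\1%VF : 'End(V))).
  have p1 : has_symbol (partial_op i) (fun x => x i *: (\1%VF : 'End(V))).
    have := has_symbol_partial i \1%VF.
    rewrite (_ : (fun u => _) = partial_op i) //; apply/funext => u; congr partial_op.
    by apply: smoothfun_ext => x /=; rewrite id_lfunE.
  apply: has_symbol_ext (has_symbol_comp p1 p1) => x.
  by apply/lfunP => w; rewrite comp_lfunE !scale_lfunE !id_lfunE scalerA.
have := has_symbol_sum (index_enum 'I_3) H.
rewrite (_ : \sum_(i <- _) _ = @laplacian R V); last first.
  by apply/funext => u; rewrite fct_sumE.
by apply: has_symbol_ext => x; rewrite scaler_suml.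
Qed.

(** Components are taken in each scalar factor of the pure tensors. *)
Lemma homogeneous_components P f : has_symbol P f -> exists N (Pd : nat -> op) (fd : nat -> ('I_3 -> C) -> 'End(V)),
  [/\ P = \sum_(d < N) Pd d, forall d, has_symbol (Pd d) (fd d),
      forall x, f x = \sum_(d < N) fd d x &
      forall d t x, fd d (fun i => t * x i) = t ^+ d *: fd d x].
Proof.
move=> [s Ps fs].
pose N := (\max_(c <- s) msize c.1)%N.
pose sd d := [seq (pihomog mdeg d c.1, c.2) | c <- s].
have fE x : f x = \sum_(d < N) symbol (sd d) x.
  rewrite fs /symbol; under [RHS]eq_bigr => d _ do rewrite big_map.
  rewrite exchange_big /= big_seq [RHS]big_seq; apply: eq_bigr => c cs.
  by rewrite -scaler_suml -raddf_sum -pihomog_partitionE // /N (big_rem c) //= leq_maxl.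
exists N, (fun d => tensor_op (sd d)), (fun d => symbol (sd d)).
have Hd d : has_symbol (tensor_op (sd d)) (symbol (sd d)) by exists (sd d).
split=> // [|d t x].
  have H1 := has_symbol_sum (index_enum 'I_N) (fun d : 'I_N => Hd d).
  have Pf : has_symbol P f by exists s.
  by have [] := symbol_inj Pf H1 (fun xi => fE _).
rewrite /symbol !big_map scaler_sumr; apply: eq_bigr => c _.
rewrite scalerA; congr (_ *: _); set p := pihomog _ _ _.
rewrite !mevalE mulr_sumr !big_seq; apply: eq_bigr => a ap.
have /dhomogP/(_ _ ap) /= <- : p \is ishomog1 d mdeg by exact: pihomogP.
rewrite mulrCA; congr (_ * _); rewrite mdegE -prodrXr -big_split.
by apply: eq_bigr => i _; rewrite exprMn.
Qed.
End HasSymbol.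

(** * Rotations of polynomials and of vector fields *)

Section Rotations.
Variables (R : realType).
Local Notation C := R[i].
Local Notation R3 := 'cV[R]_3.
Local Notation M3 := 'M[R]_3.
Local Notation poly3 := (mpoly 3 C).
Implicit Types (k Y : M3) (p q : poly3) (x : R3).

Lemma SO3_tr k : SO3 k -> SO3 k^T.
Proof. by move=> Sk; split; [rewrite trmxK SO3_trmx | rewrite det_tr; case: Sk]. Qed.

Lemma mpoly_pt_inj p q : (forall x, meval (realpt x) p = meval (realpt x) q) -> p = q.
Proof.
move=> pq; apply: mpoly_real_inj => x; have := pq (\col_i x i).
by rewrite !(@meval_eq _ _ _ (fun i => (x i)%:C)) // => i; rewrite /realpt mxE.
Qed.

Lemma meval_mrot k p x : meval (realpt x) (mrot k p) = meval (realpt (invmx k *m x)) p.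
Proof.
rewrite mrotE; apply: meval_eq => i; rewrite /realpt mxE (raddf_sum (real_complex R)).
by apply: eq_bigr => j _; rewrite -rmorphM.
Qed.

(** Polynomials are compared through their values at real points, where [mrot k]
   is composition with the inverse rotation. *)
Lemma mrot_trK k p : SO3 k -> mrot k (mrot k^T p) = p.
Proof.
move=> Sk; apply: mpoly_pt_inj => x; rewrite !meval_mrot (SO3_inv Sk).
by rewrite (SO3_inv (SO3_tr Sk)) trmxK mulmxA Sk.1 mul1mx.
Qed.

Definition hpoly m (p : Harm R m) : poly3 := mpoly_of_dhomog (vsval p).

Lemma hpoly_inj m : injective (@hpoly m).
Proof. by move=> p q /val_inj/val_inj. Qed.

Lemma hpoly_is_linear m : linear (@hpoly m).
Proof. by move=> a p q; rewrite /hpoly !linearP. Qed.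
HB.instance Definition _ m := GRing.isLinear.Build C (Harm R m) poly3 _ (@hpoly m) (@hpoly_is_linear m).

Lemma hpoly_tau m k (p : Harm R m) : SO3 k -> hpoly (tau m k p) = mrot k (hpoly p).
Proof. by move=> Sk; rewrite /hpoly tauE. Qed.

Lemma tau_trK m k : SO3 k -> (tau m k \o tau m k^T)%VF = \1%VF.
Proof.
move=> Sk; apply/lfunP => p; rewrite comp_lfunE id_lfunE; apply: hpoly_inj.
by rewrite !hpoly_tau ?mrot_trK //; exact: SO3_tr.
Qed.

(** The derivative at [t = 0] of [p (exp (- t Y) x)]. *)
Definition dmrot Y p : poly3 :=
  - \sum_(i < 3) \sum_(j < 3) (Y i j)%:C *: (mpolyX C (mnm1 j) * mderiv i p).

Lemma dmrot_is_linear Y : linear (dmrot Y).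
Proof.
move=> a p q; rewrite /dmrot scalerN -opprD scaler_sumr -big_split; congr (- _).
apply: eq_bigr => i _ /=; rewrite scaler_sumr -big_split; apply: eq_bigr => j _ /=.
by rewrite linearP mulrDr scalerDr -scalerAr !scalerA mulrC.
Qed.
HB.instance Definition _ Y := GRing.isLinear.Build C poly3 poly3 _ (dmrot Y) (dmrot_is_linear Y).

Lemma dmrotM Y p q : dmrot Y (p * q) = dmrot Y p * q + p * dmrot Y q.
Proof.
rewrite /dmrot mulNr mulrN -opprD mulr_suml mulr_sumr -big_split; congr (- _).
apply: eq_bigr => i _ /=; rewrite mulr_suml mulr_sumr -big_split; apply: eq_bigr => j _ /=.
by rewrite mderivM mulrDr scalerDr -scalerAl -scalerAr mulrA (mulrCA p) !mulrA.
Qed.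

Lemma meval_dmrot Y p x : meval (realpt x) (dmrot Y p) =
  - \sum_(i < 3) ((Y *m x) i 0)%:C * meval (realpt x) (mderiv i p).
Proof.
rewrite /dmrot mevalN; congr (- _); rewrite raddf_sum; apply: eq_bigr => i _ /=.
rewrite raddf_sum mxE (raddf_sum (real_complex R)) mulr_suml; apply: eq_bigr => j _ /=.
by rewrite mevalZ mevalM mevalXU mulrA /realpt -rmorphM.
Qed.

(** The chain rule: the gradient of [p (k^T x)] is [k] applied to the gradient
   of [p] at [k^T x]. *)
Lemma mrot_dmrot k Y p : SO3 k -> mrot k (dmrot Y p) = dmrot (k *m Y *m k^T) (mrot k p).
Proof.
move=> Sk; apply: mpoly_pt_inj => x; rewrite meval_mrot !meval_dmrot; congr (- _).
have dE i : meval (realpt x) (mderiv i (mrot k p)) =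
    \sum_l (invmx k l i)%:C * meval (realpt (invmx k *m x)) (mderiv l p).
  rewrite /mrot mderiv_comp raddf_sum; apply: eq_bigr => l _ /=.
  rewrite mderiv_linform mevalM mevalC mulrC; congr (_ * _).
  exact: meval_mrot.
under [RHS]eq_bigr => i _ do rewrite dE mulr_sumr.
rewrite exchange_big; apply: eq_bigr => l _ /=.
under eq_bigr => i _ do rewrite mulrA mulrC.
rewrite -mulr_sumr mulrC; congr (_ * _).
under eq_bigr => i _ do rewrite mulrC -rmorphM.
rewrite -(raddf_sum (real_complex R)); congr (_%:C).
transitivity ((invmx k *m (k *m Y *m k^T *m x)) l 0); last by rewrite mxE.
by rewrite (SO3_inv Sk) !mulmxA SO3_trmx // mul1mx.
Qed.

Section Equivariance.
Variable m : nat.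
Local Notation V := (Harm R m).

Lemma rot_act_exp k xi w : SO3 k ->
  rot_act k (expfun xi w) = expfun (k *m xi) (tau m k w).
Proof.
move=> Sk; apply: smoothfun_ext => x /=; rewrite /expfct linearZ; congr ((expR _)%:C *: _).
have E (y z : R3) : dotp y z = (y^T *m z) 0 0.
  by rewrite mxE; apply: eq_bigr => i _; rewrite mxE.
by rewrite !E (SO3_inv Sk) trmx_mul mulmxA.
Qed.

(** Rotating the exponential [exp (xi . x) w] gives the exponential with
   covector [k xi] and vector [tau k w]; both sides are evaluated at 0. *)
Lemma invariant_symbol (P : smoothfun V -> smoothfun V) f : has_symbol P f ->
  (forall k, SO3 k -> forall u, P (rot_act k u) = rot_act k (P u)) ->
  forall k xi, SO3 k -> (f (realpt (k *m xi)) \o tau m k = tau m k \o f (realpt xi))%VF.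
Proof.
move=> Pf Pk k xi Sk; apply/lfunP => w; rewrite !comp_lfunE.
have := congr1 (fun u : smoothfun V => u 0) (Pk k Sk (expfun xi w)).
rewrite rot_act_exp // (has_symbol_exp _ _ _ Pf) /=.
rewrite mulmx0 (has_symbol_exp _ _ _ Pf) linearZ /=.
by rewrite !linear0 expR0 !scale1r.
Qed.

Lemma rot_act_is_linear k : linear (@rot_act R m k).
Proof. by move=> a u w; apply: smoothfun_ext => x /=; rewrite linearP. Qed.
HB.instance Definition _ k := GRing.isLinear.Build C (smoothfun V) (smoothfun V) _
  (@rot_act R m k) (rot_act_is_linear k).

(** The chain rule for a linear change of variables. *)
Lemma partial_precomp k i (u : smoothfun V) :
  partial_op i (precomp_op k u) = \sum_j (k j i)%:C *: precomp_op k (partial_op j u).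
Proof.
have d1 x l := @cdiff_comp R R3 R3 (mulmx k) (vcoord l \o u) x (delta_mx i 0)
  (@mulmx_continuous R k) ((smoothfunP u 1%N).1 (k *m x) l).
apply: smoothfun_ext => x; apply: vcoordP => l.
rewrite smoothfun_sum {2}/vcoord linear_sum /=.
have -> : vcoord l (partial i (fun y => u (k *m y)) x) = cderive (vcoord l \o u) (k *m x) (k *m delta_mx i 0).
  rewrite -(d1 x l).2; exact (vcoord_vderive _ x (delta_mx i 0) l).
have -> : k *m delta_mx i 0 = \sum_j k j i *: (delta_mx j 0 : R3).
  apply/matrixP => j o; rewrite ord1 summxE (bigD1 j) //= big1 ?addr0 => [|j' ne].
    rewrite !mxE !eqxx mulr1 (bigD1 i) //= big1 ?addr0 => [|i' ne].
      by rewrite !mxE !eqxx mulr1.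
    by rewrite !mxE (negbTE ne) mulr0.
  by rewrite !mxE (eq_sym j) (negbTE ne) mulr0.
rewrite cderive_sum; last exact: ((smoothfunP u 1%N).1 (k *m x) l).
apply: eq_bigr => j _; rewrite linearZ /=; congr (_ * _).
exact (esym (vcoord_vderive u (k *m x) (delta_mx j 0) l)).
Qed.

Lemma partial_rot_act k i (u : smoothfun V) : SO3 k ->
  partial_op i (rot_act k u) = \sum_j (k i j)%:C *: rot_act k (partial_op j u).
Proof.
move=> Sk; rewrite /rot_act partial_postcomp partial_precomp linear_sum.
by apply: eq_bigr => j _; rewrite linearZ (SO3_inv Sk) mxE.
Qed.

Lemma laplacian_rot_act k u : SO3 k -> laplacian (@rot_act R m k u) = rot_act k (laplacian u).
Proof.
move=> Sk; rewrite /laplacian.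
transitivity (\sum_i \sum_j \sum_l (k i j * k i l)%:C *: rot_act k (partial_op l (partial_op j u))).
  apply: eq_bigr => i _; rewrite partial_rot_act // linear_sum; apply: eq_bigr => j _.
  rewrite linearZ /= partial_rot_act // scaler_sumr; apply: eq_bigr => l _.
  by rewrite scalerA -rmorphM.
rewrite exchange_big linear_sum; apply: eq_bigr => j _ /=.
rewrite exchange_big (bigD1 j) //= [X in _ + X]big1 ?addr0 => [|l ne];
  rewrite -scaler_suml -(raddf_sum (real_complex R)).
  rewrite (_ : \sum_i _ = (k^T *m k) j j); first by rewrite SO3_trmx // mxE eqxx scale1r.
  by rewrite mxE; apply: eq_bigr => i _; rewrite mxE.
rewrite (_ : \sum_i _ = (k^T *m k) j l); first by rewrite SO3_trmx // mxE eq_sym (negbTE ne) scale0r.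
by rewrite mxE; apply: eq_bigr => i _; rewrite mxE.
Qed.

End Equivariance.
End Rotations.

(** * Differentiable paths of polynomials *)

Lemma cdiffM (R : realType) (E : normedModType R) (f g : E -> R[i]) (x v : E) :
  cdifferentiable f x -> cdifferentiable g x ->
  cdifferentiable (fun y => f y * g y) x /\
  cderive (fun y => f y * g y) x v = cderive f x v * g x + f x * cderive g x v.
Proof.
move=> [fr fi] [gr gi].
pose fR y := complex.Re (f y); pose fI y := complex.Im (f y).
pose gR y := complex.Re (g y); pose gI y := complex.Im (g y).
have eR : (fun y => complex.Re (f y * g y)) = fR * gR - fI * gI.
  by apply/funext => y; rewrite !fctE /fR /fI /gR /gI; case: (f y) (g y) => [? ?] [? ?].
have eI : (fun y => complex.Im (f y * g y)) = fR * gI + fI * gR.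
  by apply/funext => y; rewrite !fctE /fR /fI /gR /gI; case: (f y) (g y) => [? ?] [? ?].
have [dfr dfi] := (diff_derivable (v := v) fr, diff_derivable (v := v) fi).
have [dgr dgi] := (diff_derivable (v := v) gr, diff_derivable (v := v) gi).
rewrite /cdifferentiable /cderive eR eI; split.
  split; [apply: differentiableB|apply: differentiableD]; exact: differentiableM.
rewrite (deriveB (derivableM dfr dgr) (derivableM dfi dgi)).
rewrite (deriveD (derivableM dfr dgi) (derivableM dfi dgr)).
rewrite (deriveM dfr dgr) (deriveM dfi dgi) (deriveM dfr dgi) (deriveM dfi dgr).
rewrite -/fR -/fI -/gR -/gI.
have -> : f x = fR x +i* fI x by rewrite /fR /fI; case: (f x).
have -> : g x = gR x +i* gI x by rewrite /gR /gI; case: (g x).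
move: ('D_v fR x) ('D_v fI x) ('D_v gR x) ('D_v gI x) (fR x) (fI x) (gR x) (gI x) => a b c d e f' g' h.
by apply/eqP; rewrite eq_complex /= /GRing.scale /=; apply/andP; split; apply/eqP; ring.
Qed.

Section Paths.
Variable R : realType.
Local Notation C := R[i].
Local Notation poly3 := (mpoly 3 C).

(** Differentiability at 0 is imposed coefficient by coefficient, so that no
   topology on the space of polynomials is involved. *)
Definition path_derive (q : R -> poly3) (q' : poly3) := forall b,
  cdifferentiable (fun t => mcoeff b (q t)) 0 /\
  cderive (fun t => mcoeff b (q t)) 0 1 = mcoeff b q'.

Lemma path_derive_cst q : path_derive (fun _ => q) 0.
Proof.
move=> b; rewrite mcoeff0; split; first by split; exact: differentiable_cst.
by rewrite /cderive !derive_cst.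
Qed.

Lemma path_deriveP a q1 q1' q2 q2' : path_derive q1 q1' -> path_derive q2 q2' ->
  path_derive (fun t => a *: q1 t + q2 t) (a *: q1' + q2').
Proof.
move=> h1 h2 b; have [d1 e1] := h1 b; have [d2 e2] := h2 b.
have -> : (fun t => mcoeff b (a *: q1 t + q2 t)) = (fun t => a * mcoeff b (q1 t) + mcoeff b (q2 t)).
  by apply/funext => t; rewrite mcoeffD mcoeffZ.
by rewrite mcoeffD mcoeffZ -e1 -e2; exact: cdiffP.
Qed.

Lemma path_derive_sum (I : Type) (r : seq I) (q : I -> R -> poly3) (q' : I -> poly3) :
  (forall i, path_derive (q i) (q' i)) ->
  path_derive (fun t => \sum_(i <- r) q i t) (\sum_(i <- r) q' i).
Proof.
move=> h; elim: r => [|i r IH].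
  rewrite big_nil (_ : (fun t => _) = fun _ => 0); last by apply/funext => t; rewrite big_nil.
  exact: path_derive_cst.
rewrite big_cons (_ : (fun t => _) = fun t => 1 *: q i t + \sum_(i <- r) q i t).
  by rewrite -[X in X + _]scale1r; exact: path_deriveP.
by apply/funext => t; rewrite big_cons scale1r.
Qed.

Lemma cdiff_finsum (I : Type) (r : seq I) (P : pred I) (f : I -> R -> C) :
  (forall i, cdifferentiable (f i) 0) ->
  cdifferentiable (fun t => \sum_(i <- r | P i) f i t) 0 /\
  cderive (fun t => \sum_(i <- r | P i) f i t) 0 1 = \sum_(i <- r | P i) cderive (f i) 0 1.
Proof.
move=> fd; elim: r => [|j s [IH1 IH2]].
  have -> : (fun y => \sum_(j <- [::] | P j) f j y) = fun _ => 0.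
    by apply/funext => y; rewrite big_nil.
  by rewrite big_nil; exact: cdiff0.
rewrite big_cons (_ : (fun y => _) = (fun y => if P j then f j y + \sum_(j <- s | P j) f j y
    else \sum_(j <- s | P j) f j y)); last by apply/funext => y; rewrite big_cons.
case: (P j) => //; rewrite -IH2.
have [] := @cdiffP R R 1 _ _ 0 1 (fd j) IH1; rewrite mul1r.
by under eq_fun => y do rewrite mul1r.
Qed.

Lemma path_deriveM q1 q1' q2 q2' : path_derive q1 q1' -> path_derive q2 q2' ->
  path_derive (fun t => q1 t * q2 t) (q1' * q2 0 + q1 0 * q2').
Proof.
move=> h1 h2 b.
have -> : (fun t => mcoeff b (q1 t * q2 t)) = (fun t =>
   \sum_(k : bmultinom 3 (mdeg b).+1 * bmultinom 3 (mdeg b).+1 | b == mnm_add k.1 k.2)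
     mcoeff k.1 (q1 t) * mcoeff k.2 (q2 t)).
  by apply/funext => t; rewrite mcoeffM.
have d k1 k2 := @cdiffM R R _ _ 0 1 (h1 k1).1 (h2 k2).1.
have [] := @cdiff_finsum _ (index_enum (bmultinom 3 (mdeg b).+1 * bmultinom 3 (mdeg b).+1)%type)
   (fun k => b == mnm_add k.1 k.2) _ (fun k => (d k.1 k.2).1).
move=> ds ->; split=> //; rewrite mcoeffD !mcoeffM -big_split; apply: eq_bigr => k _ /=.
by rewrite (d k.1 k.2).2 (h1 _).2 (h2 _).2.
Qed.
End Paths.

(** * The exponential on the basis of so(3) *)

Lemma det_mx33 (A : comNzRingType) (M : 'M[A]_3) :
  \det M = M 0 0 * (M 1 1 * M 2 2 - M 1 2 * M 2 1)
         - M 0 1 * (M 1 0 * M 2 2 - M 1 2 * M 2 0)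
         + M 0 2 * (M 1 0 * M 2 1 - M 1 1 * M 2 0).
Proof.
pose m (i j : nat) := M (inord i) (inord j).
have -> : M = \matrix_(i, j) m i j by apply/matrixP => i j; rewrite mxE /m !inord_val.
rewrite (expand_det_row _ 0) !big_ord_recl big_ord0 /cofactor.
rewrite !(expand_det_row _ 0) !big_ord_recl !big_ord0 /cofactor !det_mx11 !mxE /=.
rewrite /bump /=; ring.
Qed.

Section Rodrigues.
Variable R : realType.
Local Notation M3 := 'M[R]_3.
Implicit Types (Y : M3) (t : R).

(** Rodrigues' formula for [exp (t Y)]. *)
Definition rodrigues Y t : M3 := 1 + Y ^+ 2 + (sin t *: Y - cos t *: Y ^+ 2).

(** The relation [Y^3 = - Y] makes the powers of [Y] periodic up to sign: the odd
   ones are [Y] or [- Y] and the even ones, from the second on, [Y^2] or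
   [- Y^2].  The coefficients are arranged to match the series of sine and
   cosine; at [n = 0] the cosine term contributes [- Y^2], which the first
   summand corrects. *)
Lemma powers_rodrigues (K : unitRingType) (A : lalgType K) (Y : A) n : Y ^+ 3 = - Y ->
  Y ^+ n = (n == 0%N)%:R *: (1 + Y ^+ 2) +
    (((odd n)%:R * (-1) ^+ n.-1./2) *: Y - ((~~ odd n)%:R * (-1) ^ n./2) *: Y ^+ 2).
Proof.
move=> Y3.
have even k : Y ^+ k.*2.+2 = (-1) ^+ k *: Y ^+ 2.
  elim: k => [|k IH]; first by rewrite scale1r.
  rewrite doubleS -[k.*2.+4]addn2 exprD IH -scalerAl -exprD -[(2 + 2)%N]/(3 + 1)%N exprD Y3.
  by rewrite expr1 mulNr -expr2 scalerN (exprS (-1)) mulN1r scaleNr.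
case: n => [|n]; first by rewrite /= !mul0r !mul1r scale0r sub0r !scale1r addrK.
rewrite /= scale0r add0r negbK -exprnP; case: (boolP (odd n)) => on.
  have -> : n.+1 = n./2.*2.+2 by rewrite -{1}(odd_double_half n) on.
  by rewrite uphalf_half on mul0r scale0r sub0r mul1r even (exprS (-1)) mulN1r scaleNr opprK.
have -> : n.+1 = n./2.*2.+1 by rewrite -{1}(odd_double_half n) (negbTE on).
rewrite mul0r scale0r subr0 mul1r.
case: (n./2) => [|k]; first by rewrite scale1r.
by rewrite doubleS exprSr even -scalerAl -exprSr Y3 (exprS (-1)) mulN1r scaleNr scalerN.
Qed.

Lemma expmx_rodrigues Y t : Y ^+ 3 = - Y -> expmx (t *: Y) = rodrigues Y t.
Proof.
move=> Y3; rewrite /expmx.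
have -> : (fun n : nat => n`!%:R^-1 *: (t *: Y) ^+ n) = (fun n =>
    (n == 0%N)%:R *: (1 + Y ^+ 2) + (sin_coeff t n *: Y - cos_coeff t n *: Y ^+ 2)).
  apply/funext => n; rewrite exprZn {1}(powers_rodrigues n Y3) /sin_coeff /cos_coeff /=.
  rewrite scalerA [LHS]scalerDr scalerBr !scalerA; congr (_ *: _ + (_ *: _ - _ *: _)).
  - by case: n => [|n]; rewrite ?mulr0 //= fact0 invr1 expr0 !mulr1.
  - by ring.
  - by ring.
apply/cvg_lim => //.
rewrite -(cvg_shiftS _) /=.
have -> : (fun n => series (fun n : nat =>
    (n == 0%N)%:R *: (1 + Y ^+ 2) + (sin_coeff t n *: Y - cos_coeff t n *: Y ^+ 2)) n.+1) =
  (fun n => 1 + Y ^+ 2 + (series (sin_coeff t) n.+1 *: Y - series (cos_coeff t) n.+1 *: Y ^+ 2)).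
  apply/funext => n; rewrite !seriesEnat /= big_split sumrB !scaler_suml; congr (_ + _).
  rewrite big_nat_recl //= scale1r big1_seq ?addr0 // => i _.
  by rewrite scale0r.
apply: cvgD; first exact: cvg_cst.
apply: cvgB; apply: cvgZr_tmp; rewrite (cvg_shiftS (series _)).
  by rewrite unlock; exact: is_cvg_series_sin_coeff.
by rewrite unlock; exact: is_cvg_series_cos_coeff.
Qed.
End Rodrigues.

Section RotationPaths.
Variable R : realType.
Local Notation M3 := 'M[R]_3.
Implicit Types (Y : M3) (t : R).

Lemma so3_basis_tr i : (so3_basis R i)^T = - so3_basis R i.
Proof.
case: i => [[|[|[|//]]] lt]; rewrite /so3_basis /= /Y1 /Y2 /Y3 /mx3;
  apply/matrixP => [[[|[|[|//]]] ?] [[|[|[|//]]] ?]]; rewrite !mxE /= ?oppr0 ?opprK //.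
Qed.

Lemma so3_basis_sqr i : so3_basis R i ^+ 2 = diag_mx (\row_j ((j == i)%:R - 1)).
Proof.
case: i => [[|[|[|//]]] lt]; rewrite /so3_basis /= /Y1 /Y2 /Y3 /mx3 expr2 -mulmxE;
  apply/matrixP => [[[|[|[|//]]] ?] [[|[|[|//]]] ?]];
  rewrite !mxE !big_ord_recl big_ord0 !mxE /=; ring.
Qed.

Lemma so3_basis_cube i : so3_basis R i ^+ 3 = - so3_basis R i.
Proof.
rewrite exprS so3_basis_sqr -mulmxE.
case: i => [[|[|[|//]]] lt]; rewrite /so3_basis /= /Y1 /Y2 /Y3 /mx3;
  apply/matrixP => [[[|[|[|//]]] ?] [[|[|[|//]]] ?]];
  rewrite !mxE !big_ord_recl big_ord0 !mxE /=; ring.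
Qed.

Lemma rodrigues_entry i t j l : rodrigues (so3_basis R i) t j l =
   (j == l)%:R * (1 + ((j == i)%:R - 1) * (1 - cos t)) + sin t * so3_basis R i j l.
Proof.
rewrite /rodrigues so3_basis_sqr !mxE; case: (j =P l) => [->|_] /=; last by rewrite !mulr0n; ring.
by rewrite !mulr1n; ring.
Qed.

Lemma rodrigues_SO3 i t : SO3 (rodrigues (so3_basis R i) t).
Proof.
have cs : cos t * cos t = 1 - sin t * sin t :> R by rewrite -(cos2Dsin2 t); ring.
split.
  apply/matrixP => j l; rewrite mxE.
  under eq_bigr => n _ do rewrite [X in _ * X]mxE !rodrigues_entry.
  rewrite !mxE !big_ord_recl big_ord0.
  case: i => [[|[|[|//]]] ?]; case: j => [[|[|[|//]]] ?]; case: l => [[|[|[|//]]] ?];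
    rewrite /so3_basis /= /Y1 /Y2 /Y3 /mx3 !mxE /=; move: cs; move: (cos t) (sin t) => c s cs; rewrite -[RHS]addr0; lra.
rewrite det_mx33 !rodrigues_entry.
case: i => [[|[|[|//]]] ?];
    rewrite /so3_basis /= /Y1 /Y2 /Y3 /mx3 !mxE /=; move: cs; move: (cos t) (sin t) => c s cs; lra.
Qed.
End RotationPaths.

(** * The derived representation on harmonic polynomials *)

Section DerivedRepresentation.
Variable R : realType.
Local Notation C := R[i].
Local Notation M3 := 'M[R]_3.
Local Notation poly3 := (mpoly 3 C).
Implicit Types (Y : M3) (t : R) (p : poly3).

Let K i t := rodrigues (so3_basis R i) t.

Lemma rodrigues_derive i j l :
  cdifferentiable (fun t => (K i t j l)%:C) 0 /\ cderive (fun t => (K i t j l)%:C) 0 1 = (so3_basis R i j l)%:C.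
Proof.
pose a : R := (j == l)%:R; pose b : R := (j == i)%:R - 1; pose y := so3_basis R i j l.
have d0 : is_derive (0 : R) (1 : R) (fun t => K i t j l) y.
  have -> : (fun t => K i t j l) = (fun t => a * (1 + b * (1 - cos t)) + sin t * y).
    by apply/funext => t; rewrite /K rodrigues_entry.
  apply: is_derive_eq; rewrite !scaler0 cos0 sin0 /GRing.scale /=; ring.
have c0 : is_derive (0 : R) (1 : R) (fun t => 0 : R) 0 by exact: is_derive_cst.
split; last by rewrite /cderive /= !derive_val.
split; apply/derivable1_diffP.
- by case: d0.
- by case: c0.
Qed.

(** Both sides obey the Leibniz rule, so it is enough to differentiate the
   coordinate functions. *)
Lemma mrot_path_derive i p : path_derive (fun t => mrot (K i t) p) (dmrot (so3_basis R i) p).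
Proof.
have K0 : K i 0 = 1%:M.
  apply/matrixP => j l; rewrite /K rodrigues_entry cos0 sin0 !mxE; ring.
have q0 q : mrot (K i 0) q = q.
  apply: mpoly_pt_inj => x; rewrite meval_mrot K0; apply: meval_eq => j.
  by rewrite (_ : invmx 1%:M = 1%:M) ?mul1mx // invmx1.
pose D q := path_derive (fun t => mrot (K i t) q) (dmrot (so3_basis R i) q).
have cM t : {morph mrot (K i t) : q r / q * r} by exact: rmorphM.
have DM q r : D q -> D r -> D (q * r).
  move=> Dq Dr; rewrite /D dmrotM -[X in _ * X + _](q0 r) -[X in _ + X * _](q0 q).
  rewrite (_ : (fun t => _) = (fun t => mrot (K i t) q * mrot (K i t) r)); first exact (path_deriveM Dq Dr).
  by apply/funext => t; rewrite cM.
have DZ a q r : D q -> D r -> D (a *: q + r).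
  move=> Dq Dr; rewrite /D linearP /=.
  rewrite (_ : (fun t => _) = (fun t => a *: mrot (K i t) q + mrot (K i t) r)); first exact (path_deriveP a Dq Dr).
  by apply/funext => t; rewrite mrot_is_linear.
have D1 : D 1.
  rewrite /D (_ : (fun t => _) = fun _ => 1).
    rewrite (_ : dmrot _ 1 = 0); first exact: path_derive_cst.
    rewrite /dmrot big1 ?oppr0 // => j _; rewrite big1 // => l _.
    by rewrite -[1]/(mpolyC 3 1) mderivC mulr0 scaler0.
  by apply/funext => t; rewrite /mrot comp_mpoly1.
have DX j : D (mpolyX C (mnm1 j)).
  rewrite /D.
  have -> : (fun t => mrot (K i t) (mpolyX C (mnm1 j))) =
      (fun t => \sum_l (K i t l j)%:C *: mpolyX C (mnm1 l)).
    apply/funext => t; rewrite /mrot comp_mpolyXU -tnth_nth tnth_mktuple (SO3_inv (rodrigues_SO3 i t)).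
    by apply: eq_bigr => l _; rewrite mxE.
  have -> : dmrot (so3_basis R i) (mpolyX C (mnm1 j)) =
      \sum_l (so3_basis R i l j)%:C *: mpolyX C (mnm1 l).
    rewrite /dmrot (bigD1 j) //= [X in _ + X]big1 ?addr0 => [|l ne].
      rewrite -sumrN; apply: eq_bigr => l _.
      rewrite mderivX mnm1E eqxx scale1r -{1}(add0m (mnm1 j)) addmK mpolyX0 mulr1.
      rewrite -scaleNr -rmorphN; congr (_%:C *: _).
      by have := so3_basis_tr R i => /matrixP/(_ l j); rewrite !mxE => ->; rewrite opprK.
    rewrite big1 // => l' _.
    by rewrite mderivX mnm1E eq_sym (negbTE ne) scale0r mulr0 scaler0.
  apply: path_derive_sum => l b; have [d e] := rodrigues_derive i l j.
  have [d1 e1] := @cdiffP R R (mcoeff b (mpolyX C (mnm1 l))) _ _ 0 1 d (cdiff0 (0 : R) (1 : R)).1.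
  rewrite (_ : (fun t => _) = (fun t => mcoeff b (mpolyX C (mnm1 l)) * (K i t l j)%:C + 0)).
    by split=> //; rewrite e1 (cdiff0 _ _).2 addr0 e mcoeffZ mulrC.
  by apply/funext => t; rewrite mcoeffZ mulrC addr0.
rewrite -/(D p); elim/mpolyind: p => [|a b p _ _ Dp].
  rewrite /D linear0 (_ : (fun t => _) = fun _ => 0); first exact: path_derive_cst.
  by apply/funext => t; rewrite /mrot comp_mpoly0.
have DXb : D (mpolyX C b).
  rewrite mpolyXE_id; apply: (big_ind D); [exact: D1 | exact: DM | move=> j _].
  elim: (b j) => [|d IH]; first by rewrite expr0; exact: D1.
  by rewrite exprS; exact (DM _ _ (DX j) IH).
exact (DZ a _ _ DXb Dp).
Qed.

End DerivedRepresentation.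

Section Lift.
Variables (R : realType) (m : nat).
Local Notation C := R[i].
Local Notation poly3 := (mpoly 3 C).
Local Notation V := (Harm R m).
Local Notation mono := (bmultinom 3 m.+1).
Implicit Types (p q : V) (T : poly3 -> poly3).

Definition matrix_unit (a b : mono) (p : V) : V :=
  mcoeff a (hpoly p) *: vsproj (harmonics R m) (indhomog m (mpolyX C b)).

Lemma matrix_unit_is_linear a b : linear (matrix_unit a b).
Proof.
by move=> x p q; rewrite /matrix_unit hpoly_is_linear mcoeffD mcoeffZ scalerDl scalerA.
Qed.
HB.instance Definition _ a b := GRing.isLinear.Build C V V _ (matrix_unit a b) (matrix_unit_is_linear a b).

(** The endomorphism of the harmonics induced by an operator [T] on polynomials,
   written through the matrix coefficients of [T] on monomials.  In this form the
   coefficients carry all the dependence on [T], which reduces differentiating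
   a path of endomorphisms to differentiating scalar functions. *)
Definition induced_end T : 'End(V) :=
  \sum_(a : mono) \sum_(b : mono) mcoeff b (T (mpolyX C a)) *: linfun (matrix_unit a b).

Lemma hpoly_homog p : hpoly p \is ishomog1 m mdeg.
Proof. exact: dhomog_is_dhomog. Qed.

Lemma hpoly_msize p : (msize (hpoly p) <= m.+1)%N.
Proof.
have [->|nz] := eqVneq (hpoly p) 0; first by rewrite msize0.
rewrite -mlead_deg //; have /dhomogP/(_ _ (mlead_supp nz)) /= -> := hpoly_homog p.
by [].
Qed.

Lemma hpoly_mono p : hpoly p = \sum_(a : mono) mcoeff a (hpoly p) *: mpolyX C a.
Proof. exact: mpolywE (hpoly_msize p). Qed.

Lemma induced_endE (T : {linear poly3 -> poly3}) p q : T (hpoly p) = hpoly q -> induced_end T p = q.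
Proof.
move=> Tpq; rewrite /induced_end sum_lfunE.
transitivity (\sum_(b : mono) mcoeff b (hpoly q) *: vsproj (harmonics R m) (indhomog m (mpolyX C b))).
  under eq_bigr => a _ do rewrite sum_lfunE.
  rewrite exchange_big; apply: eq_bigr => b _ /=.
  under eq_bigr => a _ do rewrite scale_lfunE lfunE /= /matrix_unit scalerA.
  rewrite -scaler_suml -Tpq [in RHS]hpoly_mono linear_sum raddf_sum /=.
  by congr (_ *: _); apply: eq_bigr => a _; rewrite linearZ mcoeffZ mulrC.
transitivity (vsproj (harmonics R m) (\sum_(b : mono) mcoeff b (hpoly q) *: indhomog m (mpolyX C b))).
  by rewrite linear_sum; apply: eq_bigr => b _; rewrite linearZ.
rewrite -[RHS]vsvalK; congr (vsproj _ _); apply/val_inj.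
rewrite /= -[RHS]/(hpoly q) [RHS]hpoly_mono raddf_sum; apply: eq_bigr => b _ /=.
have [e|ne] := eqVneq (mdeg b) m.
  by congr (_ *: _); rewrite /indhomog insubdK //= -topredE /= dhomogX /= e.
by rewrite (dhomog_nemf_coeff (hpoly_homog q) ne) !scale0r.
Qed.

Lemma tau_induced k : SO3 k -> tau m k = induced_end (mrot k).
Proof.
move=> Sk; apply/lfunP => p; apply/esym.
have hl : linear (mrot (R := R) k) by exact: mrot_is_linear.
pose T : {linear poly3 -> poly3} := HB.pack (mrot (R := R) k) (GRing.isLinear.Build _ _ _ _ _ hl).
by apply: (@induced_endE T); rewrite hpoly_tau.
Qed.

Lemma induced_end_path (T : R -> poly3 -> poly3) (T' : poly3 -> poly3) :
  (forall p : poly3, path_derive (fun t => T t p) (T' p)) ->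
  vdifferentiable (fun t => induced_end (T t)) 0 /\ vderive (fun t => induced_end (T t)) 0 1 = induced_end T'.
Proof.
move=> TT.
have sumd (I : Type) (r : seq I) (g : I -> R -> 'End(V)) g' :
    (forall i, vdifferentiable (g i) 0 /\ vderive (g i) 0 1 = g' i) ->
    vdifferentiable (fun t => \sum_(i <- r) g i t) 0 /\
    vderive (fun t => \sum_(i <- r) g i t) 0 1 = \sum_(i <- r) g' i.
  move=> h; elim: r => [|i r [IH1 IH2]].
    rewrite big_nil (_ : (fun t => _) = fun _ => 0); last by apply/funext => t; rewrite big_nil.
    have z k : vcoord k \o (fun _ : R => 0 : 'End(V)) = fun _ => 0.
      by apply/funext => t; rewrite /= /vcoord linear0.
    split=> [k|]; first by rewrite z; exact: (cdiff0 (0 : R) (1 : R)).1.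
    by apply: vcoordP => k; rewrite vcoord_vderive z (cdiff0 _ _).2 /vcoord linear0.
  have [d e] := h i; rewrite big_cons -IH2 -e -[X in X + _]scale1r.
  rewrite (_ : (fun t => _) = 1 *: g i + (fun t => \sum_(i <- r) g i t)).
    exact: (@vdiffP R _ R 1 _ _ 0 1 d IH1).
  by apply/funext => t; rewrite big_cons -[g i t]scale1r.
apply: (sumd) => a; apply: (sumd) => b; have [d e] := TT (mpolyX C a) b.
set A := linfun _.
have cE k : vcoord k \o (fun t => mcoeff b (T t (mpolyX C a)) *: A) =
    (fun t => vcoord k A * mcoeff b (T t (mpolyX C a)) + 0).
  by apply/funext => t; rewrite /= /vcoord linearZ addr0 mulrC.
have h k := @cdiffP R R (vcoord k A) _ _ 0 1 d (cdiff0 (0 : R) (1 : R)).1.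
split=> [k|]; first by rewrite cE; exact: (h k).1.
apply: vcoordP => k; rewrite vcoord_vderive cE (h k).2 (cdiff0 _ _).2 addr0 e.
by rewrite /vcoord linearZ mulrC.
Qed.
End Lift.

Section DTau.
Variables (R : realType) (m : nat).
Local Notation C := R[i].
Local Notation poly3 := (mpoly 3 C).
Local Notation V := (Harm R m).
Local Notation M3 := 'M[R]_3.
Implicit Types (p : poly3) (Y : M3).

Lemma harm_exists p : p \is ishomog1 m mdeg -> mlap p = 0 -> exists q : V, hpoly q = p.
Proof.
move=> hp lp; exists (vsproj (harmonics R m) (DHomog hp)).
by rewrite /hpoly vsprojK // harmonicsE lp.
Qed.

Lemma hpoly_harmonic (q : V) : mlap (hpoly q) = 0.
Proof. by apply/eqP; rewrite -harmonicsE subvsP. Qed.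

Lemma mderiv_mulX l j p :
  mderiv l (mpolyX C (mnm1 j) * p) = (j == l)%:R *: p + mpolyX C (mnm1 j) * mderiv l p.
Proof.
rewrite mderivM mderivX mnm1E; congr (_ + _); have [->|ne] := eqVneq j l.
  by rewrite !scale1r -{1}(add0m (mnm1 l)) addmK mpolyX0 mul1r.
by rewrite !scale0r mul0r.
Qed.

Lemma mderiv_dmrot Y l p :
  mderiv l (dmrot Y p) = dmrot Y (mderiv l p) - \sum_i (Y i l)%:C *: mderiv i p.
Proof.
rewrite /dmrot mderivN -opprD; congr (- _); rewrite linear_sum -big_split; apply: eq_bigr => i _ /=.
rewrite linear_sum /=.
under eq_bigr => j _ do rewrite linearZ /= mderiv_mulX scalerDr mderiv_comm.
rewrite big_split /= addrC; congr (_ + _).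
rewrite (bigD1 l) //= eqxx scale1r big1 ?addr0 // => j ne.
by rewrite (negbTE ne) scale0r scaler0.
Qed.

(** The commutator of [d^2/dx_l^2] with the derivation is
   [- 2 sum_i Y_il d^2/dx_i dx_l]; summed over [l] it vanishes because [Y] is
   antisymmetric and second derivatives are symmetric. *)
Lemma mlap_dmrot Y p : Y^T = - Y -> mlap (dmrot Y p) = dmrot Y (mlap p).
Proof.
move=> Ya; rewrite /mlap linear_sum.
have E l : mderiv l (mderiv l (dmrot Y p)) = dmrot Y (mderiv l (mderiv l p)) -
   (\sum_i (Y i l)%:C *: mderiv i (mderiv l p)) *+ 2.
  rewrite mderiv_dmrot mderivB mderiv_dmrot [mderiv l (\sum_i _)]linear_sum mulr2n opprD addrA; congr (_ - _).
  by apply: eq_bigr => i _; rewrite linearZ /= mderiv_comm.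
under eq_bigr => l _ do rewrite E.
rewrite sumrB -[RHS]subr0; congr (_ - _); rewrite sumrMnl.
set S := \sum_l _.
(* exchanging the two summation indices changes the sign *)
suff S0 : S = - S by rewrite mulr2n {1}S0 addNr.
rewrite {1}/S exchange_big -sumrN; apply: eq_bigr => l _ /=; rewrite -sumrN.
apply: eq_bigr => i _; rewrite mderiv_comm -scaleNr -rmorphN; congr (_%:C *: _).
by move/matrixP/(_ i l): Ya; rewrite !mxE.
Qed.

Lemma dmrot_homog Y p : p \is ishomog1 m mdeg -> dmrot Y p \is ishomog1 m mdeg.
Proof.
move=> hp; rewrite /dmrot -scaleN1r; apply: rpredZ; apply: rpred_sum => i _; apply: rpred_sum => j _; apply: rpredZ.
have [->|nz] := eqVneq (mderiv i p) 0; first by rewrite mulr0 rpred0.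
have h1 : mpolyX C (mnm1 j) \is ishomog1 1 mdeg by rewrite dhomogX /= mdeg1.
have := dhomogM h1 (mderiv_homog i hp); case: m hp => [hp|n hp]; last by rewrite add1n.
case/negP: nz; apply/eqP/mpolyP => b; rewrite mcoeff_deriv mcoeff0.
by rewrite (dhomog_nemf_coeff hp) ?mul0rn //= mdegD mdeg1 addn1.
Qed.

Lemma tau_path i : vdifferentiable (fun t : R => tau m (rodrigues (so3_basis R i) t)) 0 /\
  vderive (fun t : R => tau m (rodrigues (so3_basis R i) t)) 0 1 = dtau m (so3_basis R i).
Proof.
have e : (fun t : R => tau m (rodrigues (so3_basis R i) t)) =
         (fun t : R => tau m (expmx (t *: so3_basis R i))).
  by apply/funext => t; rewrite expmx_rodrigues // so3_basis_cube.
split; last by rewrite e.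
have -> : (fun t : R => tau m (rodrigues (so3_basis R i) t)) =
    (fun t : R => induced_end m (mrot (rodrigues (so3_basis R i) t))).
  by apply/funext => t; rewrite tau_induced //; exact: rodrigues_SO3.
exact: (induced_end_path m (mrot_path_derive i)).1.
Qed.

Lemma dtauE i : dtau m (so3_basis R i) = induced_end m (dmrot (so3_basis R i)).
Proof.
rewrite -(tau_path i).2.
have -> : (fun t : R => tau m (rodrigues (so3_basis R i) t)) =
    (fun t : R => induced_end m (mrot (rodrigues (so3_basis R i) t))).
  by apply/funext => t; rewrite tau_induced //; exact: rodrigues_SO3.
exact: (induced_end_path m (mrot_path_derive i)).2.
Qed.

(** The derived representation acts on polynomials by the derivation [dmrot]. *)
Lemma hpoly_dtau i (q : V) :
  hpoly (dtau m (so3_basis R i) q) = dmrot (so3_basis R i) (hpoly q).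
Proof.
have [q' q'E] : exists q' : V, hpoly q' = dmrot (so3_basis R i) (hpoly q).
  apply: harm_exists; first exact: dmrot_homog (hpoly_homog q).
  by rewrite mlap_dmrot ?so3_basis_tr // hpoly_harmonic linear0.
by rewrite -q'E dtauE; congr hpoly; apply: induced_endE; rewrite q'E.
Qed.

(** Differentiating the relation at [t = 0] gives the commutation with the
   generator of the one-parameter group. *)
Lemma commute_dtau i (A : 'End(V)) :
  (forall t : R, (A \o tau m (rodrigues (so3_basis R i) t) = tau m (rodrigues (so3_basis R i) t) \o A)%VF) ->
  (A \o dtau m (so3_basis R i) = dtau m (so3_basis R i) \o A)%VF.
Proof.
move=> cA; pose ad (B : 'End(V)) := ((A \o B) - (B \o A))%VF.
have adl : linear ad.
  have adE B w : ad B w = A (B w) - B (A w) by rewrite /ad add_lfunE opp_lfunE !comp_lfunE.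
  move=> x B B'; apply/lfunP => w; rewrite adE [RHS]add_lfunE [in RHS]scale_lfunE !adE.
  by rewrite !add_lfunE !scale_lfunE linearP /= scalerBr opprD addrACA.
pose adL : {linear 'End(V) -> 'End(V)} := HB.pack ad (GRing.isLinear.Build _ _ _ _ _ adl).
have [d e] := tau_path i; have [_] := @vdiff_lin R _ _ adL R _ 0 1 d; rewrite e.
have -> : adL \o (fun t : R => tau m (rodrigues (so3_basis R i) t)) = fun _ => 0.
  by apply/funext => t; rewrite /= /ad cA subrr.
rewrite (_ : vderive _ _ _ = 0) => [/esym/eqP|]; first by rewrite subr_eq0 => /eqP.
apply: vcoordP => k; rewrite vcoord_vderive.
have -> : vcoord k \o (fun _ : R => 0 : 'End(V)) = fun _ => 0.
  by apply/funext => t; rewrite /= /vcoord linear0.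
by rewrite (cdiff0 _ _).2 /vcoord linear0.
Qed.
End DTau.

(** * Equivariance of the first order operator *)

Section ConjugationBasis.
Variable R : realType.
Local Notation M3 := 'M[R]_3.

Lemma matrix3_nat (k : M3) : k = \matrix_(i, j) k (inord i) (inord j).
Proof. by apply/matrixP => i j; rewrite mxE !inord_val. Qed.

(** The inverse of a rotation [k] is both its adjugate and its transpose, so [k]
   is its own cofactor matrix. *)
Lemma SO3_cofactor (m : nat -> nat -> R) : SO3 (\matrix_(i < 3, j < 3) m i j) ->
  forall i j : 'I_3, m j i = m (j.+1 %% 3)%N (i.+1 %% 3)%N * m (j.+2 %% 3)%N (i.+2 %% 3)%N -
                            m (j.+1 %% 3)%N (i.+2 %% 3)%N * m (j.+2 %% 3)%N (i.+1 %% 3)%N.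
Proof.
set k := \matrix_(_, _) _ => -[kk dk].
pose N : M3 := \matrix_(i, j) (m (j.+1 %% 3)%N (i.+1 %% 3)%N * m (j.+2 %% 3)%N (i.+2 %% 3)%N -
                            m (j.+1 %% 3)%N (i.+2 %% 3)%N * m (j.+2 %% 3)%N (i.+1 %% 3)%N).
have Nk : N *m k = 1%:M.
  rewrite -dk det_mx33; apply/matrixP => [[[|[|[|//]]] ?] [[|[|[|//]]] ?]];
    rewrite !mxE !big_ord_recl big_ord0 !mxE /= ?mulr1n ?mulr0n /bump /=; ring.
move=> i j; transitivity (N i j); last by rewrite mxE.
by rewrite -[N]mulmx1 -kk mulmxA Nk mul1mx !mxE.
Qed.

(** The adjoint representation of SO(3) is the standard one.  The entries on
   the left are, up to sign, 2 by 2 minors of [k], which are entries of [k]. *)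
Lemma so3_basis_conj (k : M3) i : SO3 k ->
  k *m so3_basis R i *m k^T = \sum_j k j i *: so3_basis R j.
Proof.
pose m (i j : nat) := k (inord i) (inord j).
have km : k = \matrix_(i, j) m i j by exact: matrix3_nat.
rewrite km => /(@SO3_cofactor m) H; clearbody m.
apply/matrixP => a b; rewrite summxE.
have E (j : 'I_3) : ((\matrix_(i, j) m i j) j i *: so3_basis R j) a b =
   (m (j.+1 %% 3)%N (i.+1 %% 3)%N * m (j.+2 %% 3)%N (i.+2 %% 3)%N -
    m (j.+1 %% 3)%N (i.+2 %% 3)%N * m (j.+2 %% 3)%N (i.+1 %% 3)%N) * so3_basis R j a b.
  by rewrite -H [LHS]mxE [in LHS]mxE.
rewrite (eq_bigr _ (fun j _ => E j)).
clear E H km; rewrite !mxE !big_ord_recl !big_ord0 !mxE !big_ord_recl !big_ord0.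
case: i => [[|[|[|//]]] ?]; case: a => [[|[|[|//]]] ?]; case: b => [[|[|[|//]]] ?];
  rewrite /so3_basis /= /Y1 /Y2 /Y3 /mx3 !mxE /= /bump /=; ring.
Qed.
End ConjugationBasis.

Section DiracSymbol.
Variables (R : realType) (m : nat).
Local Notation C := R[i].
Local Notation V := (Harm R m).
Local Notation R3 := 'cV[R]_3.
Local Notation M3 := 'M[R]_3.

(** The symbol of [Dtau]. *)
Definition dtau_symbol (x : 'I_3 -> C) : 'End(V) := \sum_i x i *: dtau m (so3_basis R i).

Lemma has_symbol_Dtau : has_symbol (@Dtau R m) dtau_symbol.
Proof.
have := has_symbol_sum (index_enum 'I_3) (fun i => has_symbol_partial i (dtau m (so3_basis R i))).
rewrite (_ : \sum_(i <- _) _ = @Dtau R m) //.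
by apply/funext => u; rewrite fct_sumE.
Qed.

Lemma dmrot_sum (I : Type) (r : seq I) (a : I -> R) (Y : I -> M3) p :
  dmrot (\sum_(i <- r) a i *: Y i) p = \sum_(i <- r) (a i)%:C *: dmrot (Y i) p.
Proof.
apply: mpoly_pt_inj => x; rewrite meval_dmrot [RHS]raddf_sum /=.
under [RHS]eq_bigr => i _ do rewrite mevalZ meval_dmrot mulrN mulr_sumr.
rewrite sumrN exchange_big; congr (- _); apply: eq_bigr => l _ /=.
rewrite mulmx_suml summxE (raddf_sum (real_complex R)) mulr_suml; apply: eq_bigr => i _ /=.
by rewrite -scalemxAl mxE rmorphM mulrA.
Qed.

Lemma tau_dtau k i : SO3 k ->
  (tau m k \o dtau m (so3_basis R i) = (\sum_j (k j i)%:C *: dtau m (so3_basis R j)) \o tau m k)%VF.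
Proof.
move=> Sk; apply/lfunP => w; rewrite !comp_lfunE; apply: hpoly_inj.
rewrite hpoly_tau // hpoly_dtau mrot_dmrot // so3_basis_conj // dmrot_sum.
rewrite sum_lfunE linear_sum; apply: eq_bigr => j _.
by rewrite scale_lfunE linearZ /= hpoly_dtau hpoly_tau.
Qed.

Lemma tau_dtau_symbol k (xi : R3) : SO3 k ->
  (tau m k \o dtau_symbol (realpt xi) = dtau_symbol (realpt (k *m xi)) \o tau m k)%VF.
Proof.
move=> Sk; apply/lfunP => w; rewrite !comp_lfunE !sum_lfunE linear_sum /=.
transitivity (\sum_i \sum_j (k j i * xi i 0)%:C *: dtau m (so3_basis R j) (tau m k w)).
  apply: eq_bigr => i _; rewrite scale_lfunE linearZ /=.
  have /lfunP/(_ w) := tau_dtau i Sk; rewrite !comp_lfunE => ->.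
  rewrite sum_lfunE scaler_sumr; apply: eq_bigr => j _.
  by rewrite scale_lfunE scalerA /realpt -rmorphM mulrC.
rewrite exchange_big; apply: eq_bigr => j _ /=.
by rewrite scale_lfunE -scaler_suml -(raddf_sum (real_complex R)) /realpt mxE.
Qed.

Lemma Dtau_rot_act k u : SO3 k -> Dtau (@rot_act R m k u) = rot_act k (Dtau u).
Proof.
move=> Sk; rewrite /Dtau.
transitivity (\sum_i \sum_j (k i j)%:C *: postcomp_op (dtau m (so3_basis R i)) (rot_act k (partial_op j u))).
  apply: eq_bigr => i _; rewrite partial_postcomp partial_rot_act // linear_sum.
  by apply: eq_bigr => j _; rewrite linearZ.
rewrite exchange_big linear_sum; apply: eq_bigr => j _ /=.
rewrite partial_postcomp; apply: smoothfun_ext => x; rewrite smoothfun_sum /=.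
have /lfunP/(_ (partial_op j u (invmx k *m x))) := tau_dtau j Sk.
rewrite !comp_lfunE => ->; rewrite [RHS]sum_lfunE; apply: eq_bigr => i _.
by rewrite scale_lfunE.
Qed.

Lemma diffop_comp (P Q : smoothfun V -> smoothfun V) : diffop P -> diffop Q -> diffop (P \o Q).
Proof.
by move=> /diffop_symbol[f Pf] /diffop_symbol[g Qg]; exact: has_symbol_diffop (has_symbol_comp Pf Qg).
Qed.

(** Stability under composition is the multiplicativity of symbols. *)
Lemma invariant_subalgebra : unital_subalgebra (@invariant_diffops R m).
Proof.
split=> [|P Q [dP cP] [dQ cQ]|a P [dP cP]|P Q [dP cP] [dQ cQ]].
- by split=> //; exact: has_symbol_diffop (has_symbol_id V).
- split=> [|k Sk u].
    have [[f Pf] [g Qg]] := (diffop_symbol dP, diffop_symbol dQ).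
    exact: has_symbol_diffop (has_symbolD Pf Qg).
  rewrite -[LHS]/(P _ + Q _) cP // cQ //.
  by rewrite -[X in _ = rot_act k X]/(P u + Q u) linearD.
- split=> [|k Sk u].
    have [f Pf] := diffop_symbol dP; exact: has_symbol_diffop (has_symbolZ a Pf).
  by rewrite -[LHS]/(a *: P _) cP // -[X in _ = rot_act k X]/(a *: P u) linearZ.
- split=> [|k Sk u]; first exact: diffop_comp.
  by rewrite /= cQ // cP.
Qed.

Lemma generated_sub_invariant :
  generated_algebra [set @laplacian R V; @Dtau R m] `<=` @invariant_diffops R m.
Proof.
apply: smallest_sub; first exact: invariant_subalgebra.
move=> _ [->|->]; split.
- exact: has_symbol_diffop (has_symbol_laplacian V).
- by move=> k Sk u; exact: laplacian_rot_act.
- exact: has_symbol_diffop has_symbol_Dtau.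
- by move=> k Sk u; exact: Dtau_rot_act.
Qed.
End DiracSymbol.

(** * Commutation relations *)

Section AngularMomentum.
Variables (R : realType).
Local Notation C := R[i].
Local Notation poly3 := (mpoly 3 C).
Local Notation "''X_' i" := (mpolyX C (mnm1 i)) (at level 8, i at level 2).
Local Notation D i := (dmrot (so3_basis R i)).
Implicit Types (p : poly3).

Lemma sum3 (M : nmodType) (F : 'I_3 -> M) : \sum_(i < 3) F i = F 0 + F 1 + F 2.
Proof.
rewrite !big_ord_recl big_ord0 addr0 addrA; congr (F _ + F _ + F _); exact/val_inj.
Qed.

Lemma dmrot_basis p :
  [/\ D 0 p = 'X_1 * mderiv 2 p - 'X_2 * mderiv 1 p,
      D 1 p = 'X_2 * mderiv 0 p - 'X_0 * mderiv 2 p &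
      D 2 p = 'X_0 * mderiv 1 p - 'X_1 * mderiv 0 p].
Proof.
have E i (x : 'cV[R]_3) l : (so3_basis R i *m x) l 0 =
    so3_basis R i l 0 * x 0 0 + so3_basis R i l 1 * x 1 0 + so3_basis R i l 2 * x 2 0.
  by rewrite mxE sum3.
have M i (x : 'cV[R]_3) : meval (realpt x) (D i p) =
    - (((so3_basis R i *m x) 0 0)%:C * meval (realpt x) (mderiv 0 p) +
       ((so3_basis R i *m x) 1 0)%:C * meval (realpt x) (mderiv 1 p) +
       ((so3_basis R i *m x) 2 0)%:C * meval (realpt x) (mderiv 2 p)).
  by rewrite meval_dmrot sum3.
have N i j k l (x : 'cV[R]_3) : meval (realpt x) ('X_i * mderiv j p - 'X_k * mderiv l p) =
    (x i 0)%:C * meval (realpt x) (mderiv j p) - (x k 0)%:C * meval (realpt x) (mderiv l p).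
  by rewrite mevalB !mevalM !mevalXU.
by split; apply: mpoly_pt_inj => x; rewrite M N !E /so3_basis /= /Y1 /Y2 /Y3 /mx3 !mxE /=;
  rewrite !mul0r !mul1r !mulN1r !add0r ?addr0 rmorphN rmorph0;
  move: (meval (realpt x) (mderiv 0 p)) (meval (realpt x) (mderiv 1 p)) (meval (realpt x) (mderiv 2 p))
    => a b c; ring.
Qed.

(** The second order parts of the two composites cancel by symmetry of second
   derivatives; the first order part is the commutator of the matrices. *)
Lemma dmrot_comm (Y Z W : 'M[R]_3) p : Z *m Y - Y *m Z = - W ->
  dmrot Z (dmrot Y p) - dmrot Y (dmrot Z p) = - dmrot W p.
Proof.
move=> ZYW; apply: mpoly_pt_inj => x.
pose d2 i l := meval (realpt x) (mderiv i (mderiv l p)).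
have E A B : meval (realpt x) (dmrot A (dmrot B p)) =
   \sum_l \sum_i ((A *m x) l 0)%:C * ((B *m x) i 0)%:C * d2 i l +
   \sum_i ((B *m A *m x) i 0)%:C * meval (realpt x) (mderiv i p).
  rewrite meval_dmrot.
  have F l : meval (realpt x) (mderiv l (dmrot B p)) =
      - (\sum_i ((B *m x) i 0)%:C * d2 i l + \sum_i (B i l)%:C * meval (realpt x) (mderiv i p)).
    rewrite mderiv_dmrot mevalB meval_dmrot opprD; congr (_ - _).
    by rewrite raddf_sum; apply: eq_bigr => i _; rewrite /= mevalZ.
  transitivity (\sum_l (\sum_i ((A *m x) l 0)%:C * ((B *m x) i 0)%:C * d2 i l +
      \sum_i ((A *m x) l 0)%:C * (B i l)%:C * meval (realpt x) (mderiv i p))).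
    rewrite -sumrN; apply: eq_bigr => l _; rewrite F mulrN opprK mulrDr !mulr_sumr.
    by congr (_ + _); apply: eq_bigr => i _; rewrite mulrA.
  rewrite big_split; congr (_ + _); rewrite exchange_big; apply: eq_bigr => i _ /=.
  rewrite -mulr_suml -mulmxA; congr (_ * _); rewrite mxE (raddf_sum (real_complex R)).
  by apply: eq_bigr => l _; rewrite mulrC -rmorphM.
have sym : \sum_l \sum_i ((Z *m x) l 0)%:C * ((Y *m x) i 0)%:C * d2 i l =
    \sum_l \sum_i ((Y *m x) l 0)%:C * ((Z *m x) i 0)%:C * d2 i l.
  rewrite exchange_big; apply: eq_bigr => l _; apply: eq_bigr => i _ /=.
  by rewrite /d2 mderiv_comm [X in X * _]mulrC.
apply: etrans (mevalB _ _ _) _; apply: etrans (congr2 (fun a b => a - b) (E Z Y) (E Y Z)) _.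
apply: etrans (esym (etrans (mevalN _ _) (congr1 -%R (meval_dmrot W p x)))).
clear E; move: sym; move: (\sum_l _) (\sum_l _) => S1 S2 ->.
rewrite opprK opprD addrACA subrr add0r -sumrB.
apply: eq_bigr => i _; rewrite -mulrBl; congr (_ * _); rewrite -rmorphB; congr (_%:C).
have -> : W = Y *m Z - Z *m Y by rewrite -[W]opprK -ZYW opprB.
by rewrite mulmxBl !mxE.
Qed.

Lemma so3_basis_comm :
  [/\ so3_basis R 0 *m so3_basis R 1 - so3_basis R 1 *m so3_basis R 0 = - so3_basis R 2,
      so3_basis R 1 *m so3_basis R 2 - so3_basis R 2 *m so3_basis R 1 = - so3_basis R 0 &
      so3_basis R 2 *m so3_basis R 0 - so3_basis R 0 *m so3_basis R 2 = - so3_basis R 1].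
Proof.
by split; rewrite /so3_basis /= /Y1 /Y2 /Y3 /mx3;
  apply/matrixP => [[[|[|[|//]]] ?] [[|[|[|//]]] ?]];
  rewrite !mxE !big_ord_recl !big_ord0 !mxE /=; ring.
Qed.

Section Endomorphisms.
Variable m : nat.
Local Notation V := (Harm R m).
Local Notation d i := (dtau m (so3_basis R i)).

Lemma dtau_comm (w : V) :
  [/\ d 0 (d 1 w) = d 1 (d 0 w) - d 2 w, d 1 (d 2 w) = d 2 (d 1 w) - d 0 w &
      d 2 (d 0 w) = d 0 (d 2 w) - d 1 w].
Proof.
have [c0 c1 c2] := so3_basis_comm.
have H i j k (w' : V) : so3_basis R i *m so3_basis R j - so3_basis R j *m so3_basis R i = - so3_basis R k ->
    d i (d j w') = d j (d i w') - d k w'.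
  move=> c; apply/eqP; rewrite addrC -subr_eq; apply/eqP/hpoly_inj.
  have dd a b : hpoly (d a (d b w')) = D a (D b (hpoly w')).
    exact: etrans (hpoly_dtau a _) (congr1 _ (hpoly_dtau b w')).
  rewrite linearB linearN /=; apply: etrans (congr2 (fun a b => a - b) (dd i j) (dd j i)) _.
  exact: etrans (dmrot_comm (hpoly w') c) (esym (congr1 -%R (hpoly_dtau k w'))).
by split; exact: H.
Qed.
End Endomorphisms.
End AngularMomentum.

(** * The weights of harmonic polynomials *)

Section HighestWeight.
Variables (R : realType) (m : nat).
Local Notation C := R[i].
Local Notation V := (Harm R m).
Local Notation poly3 := (mpoly 3 C).
Local Notation d i := (dtau m (so3_basis R i)).
Local Notation D i := (dmrot (so3_basis R i)).
Local Notation "''X_' i" := (mpolyX C (mnm1 i)) (at level 8, i at level 2).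

Definition im : C := 0 +i* 1.

Lemma imE : im * im = -1.
Proof. by apply/eqP; rewrite eq_complex /= !mul0r !mul1r sub0r addr0 oppr0 !eqxx. Qed.

(** The powers of the isotropic linear form [x_0 + i x_1] are harmonic, and
   they are highest weight vectors. *)
Definition hw_form : poly3 := 'X_0 + im *: 'X_1.
Definition hw_coef (i : 'I_3) : C := nth 0 [:: 1; im; 0] i.

Lemma mderiv_X (i j : 'I_3) : mderiv i 'X_j = mpolyC 3 (j == i)%:R.
Proof.
rewrite mderivX mnm1E; have [->|ne] := eqVneq j i; last by rewrite scale0r mpolyC0.
by rewrite scale1r -{1}(add0m (mnm1 i)) addmK mpolyX0 mpolyC1.
Qed.

Lemma mderiv_hw_form i : mderiv i hw_form = mpolyC 3 (hw_coef i).
Proof.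
rewrite /hw_form mderivD mderivZ !mderiv_X -mul_mpolyC -mpolyCM -mpolyCD; congr mpolyC.
by case: i => [[|[|[|//]]] ?]; rewrite /hw_coef /= ?mulr0 ?mulr1 ?addr0 ?add0r.
Qed.

Lemma mderiv_hw_formX i n : mderiv i (hw_form ^+ n) = (n%:R * hw_coef i) *: hw_form ^+ n.-1.
Proof.
elim: n => [|n IH]; first by rewrite expr0 mul0r scale0r -[1]/(mpolyC 3 1) mderivC.
rewrite exprS mderivM mderiv_hw_form IH mul_mpolyC -scalerAr -exprS.
have [->|n0] := posnP n; first by rewrite !mul0r scale0r addr0 mul1r.
by rewrite prednK // -scalerDl -[n.+1]add1n natrD mulrDl mul1r.
Qed.

Lemma mlap_hw_form n : mlap (hw_form ^+ n) = 0.
Proof.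
rewrite /mlap.
have E (i : 'I_3) : mderiv i (mderiv i (hw_form ^+ n)) = (hw_coef i * hw_coef i) *: ((n%:R * n.-1%:R) *: hw_form ^+ n.-2).
  rewrite mderiv_hw_formX mderivZ mderiv_hw_formX !scalerA; congr (_ *: _).
  by rewrite mulrACA mulrC.
rewrite (eq_bigr _ (fun i _ => E i)) -scaler_suml sum3 /hw_coef /= imE mul1r mul0r addr0 subrr.
by rewrite scale0r.
Qed.

Lemma hw_form_homog n : hw_form ^+ n \is ishomog1 n mdeg.
Proof.
have h1 : hw_form \is ishomog1 1 mdeg.
  by apply: rpredD; [|apply: rpredZ]; rewrite dhomogX /= mdeg1.
by have := dhomogMn n h1; rewrite mul1n.
Qed.

Lemma hw_form_neq0 : hw_form != 0.
Proof.
apply/eqP => z; have := mderiv_hw_form 0; rewrite z mderiv0 /hw_coef /= => /esym/eqP.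
by rewrite mpolyC_eq0 oner_eq0.
Qed.

Lemma dmrot_hw_formX Y n : dmrot Y (hw_form ^+ n) = n%:R *: (hw_form ^+ n.-1 * dmrot Y hw_form).
Proof.
elim: n => [|n IH].
  rewrite expr0 scale0r; apply: mpoly_pt_inj => x; rewrite meval_dmrot big1 ?oppr0 ?meval0 // => i _.
  by rewrite -[1]/(mpolyC 3 1) mderivC meval0 mulr0.
rewrite exprS dmrotM IH -scalerAr [dmrot Y hw_form * _]mulrC mulrA -exprS.
have [->|n0] := posnP n; first by rewrite scale0r addr0 scale1r.
by rewrite prednK // -[X in X + _]scale1r -scalerDl -[n.+1]add1n natrD.
Qed.

Lemma dmrot_hw_form : D 0 hw_form = - (im *: 'X_2) /\ D 1 hw_form = 'X_2 /\ D 2 hw_form = im *: 'X_0 - 'X_1.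
Proof.
have [D0 D1 D2] := dmrot_basis hw_form.
have e0 : mderiv 0 hw_form = 1 by rewrite mderiv_hw_form /hw_coef /= mpolyC1.
have e1 (p : poly3) : p * mderiv 1 hw_form = im *: p by rewrite mderiv_hw_form mulrC mul_mpolyC.
have e2 : mderiv 2 hw_form = 0 by rewrite mderiv_hw_form /hw_coef /= mpolyC0.
split; last split.
- by rewrite D0 e2 e1 mulr0 sub0r.
- by rewrite D1 e2 e0 mulr0 subr0 mulr1.
- by rewrite D2 e0 e1 mulr1.
Qed.

Lemma highest_weight_vector : exists v : V, [/\ v != 0,
  raiseE (d 0) (d 1) im v = 0 & weightH (d 2) im v = m%:R *: v].
Proof.
have [v vE] := harm_exists (hw_form_homog m) (mlap_hw_form m).
have [D0 [D1 D2]] := dmrot_hw_form.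
have dE i : hpoly (d i v) = m%:R *: (hw_form ^+ m.-1 * D i hw_form).
  exact: etrans (hpoly_dtau i v) (etrans (congr1 _ vE) (dmrot_hw_formX _ _)).
have kE : - im *: D 0 hw_form + D 1 hw_form = 0.
  by rewrite D0 D1 scaleNr scalerN opprK scalerA imE scaleN1r addNr.
have kH : - im *: D 2 hw_form = hw_form.
  by rewrite D2 scalerBr scalerA scaleNr opprK mulNr imE opprK scale1r.
exists v; split.
- apply: contraTneq isT => v0; move: vE; rewrite v0 linear0 => /esym/eqP.
  by rewrite expf_eq0 (negbTE hw_form_neq0) andbF.
- apply: hpoly_inj; rewrite /raiseE linearD linearZ linear0.
  apply: etrans (congr2 (fun a b => - im *: a + b) (dE 0) (dE 1)) _.
  move: kE; move: (D 0 hw_form) (D 1 hw_form) (hw_form ^+ m.-1) => x y z k.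
  by rewrite scalerA mulrC -scalerA scalerAr -scalerDr -mulrDr k mulr0 scaler0.
- apply: hpoly_inj; rewrite /weightH !linearZ.
  apply: etrans (congr1 (fun a => - im *: a) (dE 2)) _; rewrite /= vE.
  rewrite scalerA mulrC -scalerA scalerAr kH -exprSr.
  by have [->|m0] := posnP m; rewrite ?scale0r ?prednK.
Qed.
End HighestWeight.

Section Dimension.
Variables (R : realType) (m : nat).
Local Notation C := R[i].
Local Notation V := (Harm R m).

Definition mon3 (x y z : nat) : multinom 3 := Multinom [tuple nth 0%N [:: x; y; z] i | i < 3].

Lemma mon3E (a : multinom 3) : a = mon3 (a 0) (a 1) (a 2).
Proof.
apply/mnmP => i; rewrite mnmE.
by case: i => [[|[|[|//]]] ?]; rewrite /=; congr (a _); apply/val_inj.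
Qed.

(** The coefficients of degree at most 1 in the last variable: the Cauchy data
   on the plane where this variable vanishes. *)
Definition cauchy_data (q : V) : 'rV[C]_(m.+1 + m) :=
  row_mx (\row_j mcoeff (mon3 (m - j) j 0) (hpoly q))
         (\row_j mcoeff (mon3 (m.-1 - j) j 1) (hpoly q)).

Lemma cauchy_data_is_linear : linear cauchy_data.
Proof.
move=> x p q; rewrite /cauchy_data hpoly_is_linear; apply/rowP => j.
case: (split_ordP j) => k ->; rewrite [RHS]mxE [X in _ = X + _]mxE.
  by rewrite !row_mxEl !mxE mcoeffD mcoeffZ.
by rewrite !row_mxEr !mxE mcoeffD mcoeffZ.
Qed.
HB.instance Definition _ := GRing.isLinear.Build C V 'rV[C]_(m.+1 + m) _ cauchy_data cauchy_data_is_linear.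

(** The equation [Delta q = 0] expresses the coefficients with exponent
   [a_2 + 2] in the last variable through those with exponent [a_2]. *)
Lemma cauchy_data_inj q : cauchy_data q = 0 -> q = 0.
Proof.
move=> q0; apply: hpoly_inj; rewrite linear0; apply/mpolyP => a; rewrite mcoeff0.
have [e|ne] := eqVneq (mdeg a) m; last exact: (dhomog_nemf_coeff (hpoly_homog q) ne).
have deg (b : multinom 3) : mdeg b = (b 0%R + b 1%R + b 2%R)%N.
  by rewrite mdegE !big_ord_recl big_ord0 addn0 addnA; congr (b _ + b _ + b _)%N; apply/val_inj.
have [n] := ubnP (a 2); elim: n a e => // n IH a e an.
have [a0|agt|a1] := ltngtP (a 2) 1.
- have {}a0 : a 2 = 0%N by move: a0; case: (a 2).
  have lt : (a 1%R < m.+1)%N by rewrite ltnS -e deg a0 addn0 leq_addl.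
  have := congr1 (fun M : 'rV_(m.+1 + m) => M 0 (lshift m (Ordinal lt))) q0.
  rewrite row_mxEl !mxE /= => <-; congr mcoeff; rewrite [LHS]mon3E a0; congr mon3.
  by rewrite -e deg a0 addn0 addnK.
- have [k a2k] : exists k, a 2 = k.+2 by case: (a 2) agt => [|[|k]] // _; exists k.
  pose b := mon3 (a 0) (a 1) k.
  have := congr1 (mcoeff b) (hpoly_harmonic q); rewrite mcoeff0 /mlap raddf_sum sum3 /=.
  rewrite !mcoeff_deriv.
  pose up (i : 'I_3) := mnm_add (mnm_add b (mnm1 i)) (mnm1 i).
  have up2 : up 2 = a.
    rewrite [RHS]mon3E a2k; apply/mnmP => i; rewrite !mnmDE !mnm1E !mnmE.
    by case: i => [[|[|[|//]]] ?]; rewrite /= ?addn0 ?addn1.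
  have z (i : 'I_3) : i != 2 -> mcoeff (up i) (hpoly q) = 0.
    move=> i2; apply: IH.
      rewrite deg /up !mnmDE !mnm1E !mnmE /= -e deg a2k.
      by case: i i2 => [[|[|[|//]]] ?] //= _; rewrite ?addn0 ?addn1 !addnS ?addSn.
    rewrite /up !mnmDE !mnm1E (negbTE i2) !mnmE /= !addn0.
    by move: an; rewrite a2k !ltnS => /ltnW.
  rewrite -/(up 0) -/(up 1) -/(up 2) (z 0) // (z 1) // up2.
  move: (mcoeff a (hpoly q)) => w; rewrite !mul0rn !add0r.
  by move/eqP; rewrite !mulrn_eq0 /= => /eqP.
- have lt : (a 1%R < m)%N by rewrite -e deg a1 addn1 ltnS leq_addl.
  have := congr1 (fun M : 'rV_(m.+1 + m) => M 0 (rshift m.+1 (Ordinal lt))) q0.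
  rewrite row_mxEr !mxE /= => <-; congr mcoeff; rewrite [LHS]mon3E a1; congr mon3.
  by rewrite -e deg a1 addn1 /= addnK.
Qed.

Lemma harm_dim : (\dim {:V} <= m.*2.+1)%N.
Proof.
have /limg_dim_eq : ({:V} :&: lker (linfun cauchy_data) = 0)%VS.
  apply/eqP; rewrite -subv0; apply/subvP => q; rewrite memv_cap memvf memv_ker lfunE /= => /eqP.
  by move/cauchy_data_inj ->; rewrite mem0v.
move=> <-; apply: leq_trans (dimvS (subvf _)) _.
by rewrite dimvf /dim /= mul1n addSn addnn.
Qed.
End Dimension.

Section HarmonicStructure.
Variables (R : realType) (m : nat).
Local Notation C := R[i].
Local Notation V := (Harm R m).
Local Notation d i := (dtau m (so3_basis R i)).
Local Notation im := (@im R).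
Local Notation F := (lowerF (d 0) (d 1) im).

(** Descending from the highest weight vector. *)
Lemma weight_vectors : exists v : V, forall j, (j <= m.*2)%N ->
  iter j F v != 0 /\ d 2 (iter j F v) = (im * (m%:R - j%:R)) *: iter j F v.
Proof.
have [v [v0 Ev Hv]] := highest_weight_vector R m.
have c0 w : d 0 (d 1 w) = d 1 (d 0 w) - d 2 w by have [] := dtau_comm w.
have c1 w : d 1 (d 2 w) = d 2 (d 1 w) - d 0 w by have [] := dtau_comm w.
have c2 w : d 2 (d 0 w) = d 0 (d 2 w) - d 1 w by have [] := dtau_comm w.
exists v => j jm; have [nz H _] := ladder (imE R) c0 c1 c2 v0 Ev Hv jm.
have abstract (x y : V) (a : C) : - im *: y = a *: x -> y = (im * a) *: x.
  by move=> e; rewrite -scalerA -e scalerA mulrN imE opprK scale1r.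
by split; [exact: nz | exact: abstract H].
Qed.

Lemma dtau2_commutant (A : 'End(V)) : (A \o d 2 = d 2 \o A)%VF ->
  exists2 q : {poly C}, (size q <= m.*2.+1)%N & A = lhorner q (d 2).
Proof.
move=> cA; have [v vP] := weight_vectors.
have jm (j : 'I_m.*2.+1) : (j <= m.*2)%N by rewrite -ltnS.
apply: (@commutant_simple_spectrum _ _ _ (d 2) A (fun j : 'I_m.*2.+1 => iter j F v)
  (fun j => im * (m%:R - j%:R)) _ _ _ (harm_dim R m) cA).
- move=> j k /(mulfI _) e; apply/val_inj/eqP; rewrite -(eqr_nat C).
  have /e/addrI/oppr_inj -> // : im != 0.
  by apply/eqP => z; have := imE R; rewrite z mul0r => /eqP; rewrite eq_sym oppr_eq0 oner_eq0.
- by move=> j; have [] := vP j (jm j).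
- by move=> j; have [] := vP j (jm j).
Qed.

(** A covector of square zero at which [dtau_symbol] is the lowering operator. *)
Definition isotropic : 'I_3 -> C := nth 0 [:: - im; -1; 0].

Lemma isotropicE : \sum_i isotropic i ^+ 2 = 0.
Proof. by rewrite sum3 /isotropic /= sqrrN expr2 imE sqrrN expr1n expr0n addr0 addNr. Qed.

Lemma dtau_symbol_isotropic w : dtau_symbol m isotropic w = F w.
Proof.
rewrite /dtau_symbol sum3 /isotropic /= scale0r addr0 scaleN1r add_lfunE opp_lfunE.
by rewrite scale_lfunE.
Qed.

Lemma lpow_isotropic_neq0 j : (j <= m.*2)%N -> lpow (dtau_symbol m isotropic) j != 0.
Proof.
move=> jm; have [v vP] := weight_vectors; have [nz _] := vP j jm.
apply: contraNneq nz => z; have /lfunP/(_ v) := z; rewrite zero_lfunE => <-; apply/eqP.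
elim: j {jm z} => [|j IH]; first by rewrite lpow0.
by rewrite lpowS -IH dtau_symbol_isotropic.
Qed.
End HarmonicStructure.

(** * Rotations carrying the pole to a given covector *)

Section RotationToAxis.
Variable R : realType.
Local Notation R3 := 'cV[R]_3.
Local Notation e3 := (delta_mx 2 0 : R3).

(** For [c = 2 / |w|^2], the rotation by a half turn around the axis [w]. *)
Definition half_turn (w : R3) (c : R) : 'M[R]_3 := c *: (w *m w^T) - 1%:M.

Lemma half_turn_entry w c i j : half_turn w c i j = c * (w i 0 * w j 0) - (i == j)%:R.
Proof.
by rewrite !mxE big_ord_recl big_ord0 addr0 !mxE; congr (_ * (_ * _) - _); rewrite ?ord1 //.
Qed.

Lemma half_turn_SO3 (w : R3) c : c * (w 0 0 ^+ 2 + w 1 0 ^+ 2 + w 2 0 ^+ 2) = 2 -> SO3 (half_turn w c).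
Proof.
move=> cw; split; last first.
  rewrite det_mx33 !half_turn_entry /=.
  transitivity (c * (w 0 0 ^+ 2 + w 1 0 ^+ 2 + w 2 0 ^+ 2) - 1); first by ring.
  by rewrite cw; ring.
pose A := w *m w^T; pose s := w 0 0 ^+ 2 + w 1 0 ^+ 2 + w 2 0 ^+ 2.
have AT : A^T = A by rewrite /A trmx_mul trmxK.
have ww : w^T *m w = s%:M.
  by rewrite [LHS]mx11_scalar; congr _%:M; rewrite mxE sum3 ![_^T _ _]mxE -!expr2.
have AA : A *m A = s *: A.
  by rewrite /A mulmxA -[w *m w^T *m w]mulmxA ww mul_mx_scalar -scalemxAl.
rewrite /half_turn -/A linearB linearZ /= trmx1 AT mulmxBl mulmxBr mul1mx mulmx1.
rewrite -scalemxAl -scalemxAr AA !scalerA -mulrA cw mulr_natr mulr2n scalerDl addrK opprB.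
by rewrite addrCA subrr addr0.
Qed.

(** The half turn around the bisector [xi + r e3] exchanges [e3] and [xi / r].
   The sign of [r] is chosen such that the bisector is not zero. *)
Lemma rotation_to_axis (xi : R3) : exists r k,
  [/\ SO3 k, xi = r *: (k *m e3) & r ^+ 2 = \sum_i xi i 0 ^+ 2].
Proof.
have [->|nz] := eqVneq xi 0.
  exists 0, 1%:M; split; first by split; rewrite ?trmx1 ?mul1mx ?det1.
    by rewrite scale0r.
  by rewrite expr0n big1 // => i _; rewrite mxE expr0n.
have s0 : 0 < \sum_i xi i 0 ^+ 2.
  rewrite lt_neqAle sumr_ge0 ?andbT => [|i _]; last exact: sqr_ge0.
  apply: contraNneq nz => /esym/eqP; rewrite psumr_eq0 => [/allP z|i _]; last exact: sqr_ge0.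
  apply/eqP/matrixP => i j; rewrite ord1 mxE; apply/eqP.
  by rewrite -sqrf_eq0; apply: (implyP (z i _)); rewrite ?mem_index_enum.
pose r0 := Num.sqrt (\sum_i xi i 0 ^+ 2).
have r00 : 0 < r0 by rewrite sqrtr_gt0.
(* one of the two square roots avoids [r = - xi 2 0] *)
have [r [rn rs rx]] : exists r, [/\ r != 0, r ^+ 2 = \sum_i xi i 0 ^+ 2 & r + xi 2 0 != 0].
  have r0s : r0 ^+ 2 = \sum_i xi i 0 ^+ 2 by rewrite sqr_sqrtr // ltW.
  have [e|ne] := eqVneq (r0 + xi 2 0) 0; last by exists r0; rewrite gt_eqF.
  exists (- r0); split; [by rewrite oppr_eq0 gt_eqF | by rewrite sqrrN | ].
  by rewrite lt_eqF //; move: e r00; move: (xi 2 0) => x e r00; lra.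
pose w : R3 := xi + r *: e3; pose c := (r * (r + xi 2 0))^-1.
have we : [/\ w 0 0 = xi 0 0, w 1 0 = xi 1 0 & w 2 0 = xi 2 0 + r].
  by split; rewrite !mxE /= ?mulr0 ?mulr1 ?addr0.
have [w0 w1 w2] := we.
exists r, (half_turn w c); split=> //.
  apply: half_turn_SO3; rewrite w0 w1 w2 /c; move: rs; rewrite sum3.
  move: (xi 0 0) (xi 1 0) (xi 2 0) rx => x y z rx rs.
  have -> : x ^+ 2 + y ^+ 2 + (z + r) ^+ 2 = 2 * (r * (r + z)).
    by transitivity (r ^+ 2 + 2 * (z * r) + r ^+ 2); [rewrite {2}rs|]; ring.
  by field; apply/andP.
apply/matrixP => i j; rewrite ord1 mxE mxE sum3 !half_turn_entry.
have de (l : 'I_3) : e3 l 0 = (l == 2)%:R by rewrite mxE andbT.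
have wi : w i 0 = xi i 0 + r * (i == 2)%:R by rewrite /w mxE mxE de.
rewrite !de /= !mulr0 !add0r mulr1 w2 wi /c; clearbody w.
move: (xi i 0) (xi 2 0) ((i == 2)%:R) rx => x z dl rx; field.
by rewrite rx rn.
Qed.
End RotationToAxis.

(** * Homogeneous invariant operators *)

Section OperatorPowers.
Variables (R : realType) (V : vectType R[i]).
Local Notation C := R[i].
Local Notation op := (smoothfun V -> smoothfun V).

Definition opow (P : op) j : op := iter j (fun Q => P \o Q) id.

Lemma has_symbol_opow (P : op) f j : has_symbol P f -> has_symbol (opow P j) (fun x => lpow (f x) j).
Proof.
move=> Pf; elim: j => [|j IH]; first exact: has_symbol_id.
exact: has_symbol_comp Pf IH.
Qed.

Lemma subalgebra_opow (S : set op) (P : op) j : unital_subalgebra S -> S P -> S (opow P j).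
Proof. by move=> [S1 _ _ Sc] SP; elim: j => [//|j IH]; exact: Sc. Qed.

Lemma subalgebra_sum (S : set op) (I : Type) (r : seq I) (P : I -> op) :
  unital_subalgebra S -> (forall i, S (P i)) -> S (\sum_(i <- r) P i).
Proof.
move=> [S1 SD SZ _] SP; elim: r => [|i r IH]; last by rewrite big_cons; exact: SD.
by rewrite big_nil -(scale0r (id : op)); exact: SZ.
Qed.

Lemma lpow_scaled_id (c : C) j : lpow (c *: \1%VF : 'End(V)) j = c ^+ j *: \1%VF.
Proof.
by apply/lfunP => w; rewrite (@lpow_eigen _ _ _ _ c) ?scale_lfunE ?id_lfunE.
Qed.

Lemma lpowZ (c : C) (B : 'End(V)) j : lpow (c *: B) j = c ^+ j *: lpow B j.
Proof.
apply/lfunP => w; rewrite scale_lfunE; elim: j => [|j IH]; first by rewrite scale1r.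
by rewrite !lpowS IH scale_lfunE linearZ /= scalerA -exprS.
Qed.

Lemma lpow_intertwine (T A B : 'End(V)) j : (T \o A = B \o T)%VF -> (T \o lpow A j = lpow B j \o T)%VF.
Proof.
move=> TA; apply/lfunP => w; rewrite !comp_lfunE; elim: j => [|j IH]; first by rewrite !lpow0.
by rewrite !lpowS -IH -[LHS]comp_lfunE TA comp_lfunE.
Qed.
End OperatorPowers.

Section HomogeneousInvariants.
Variables (R : realType) (m d : nat).
Local Notation C := R[i].
Local Notation V := (Harm R m).
Local Notation R3 := 'cV[R]_3.
Local Notation op := (smoothfun V -> smoothfun V).
Local Notation e3 := (delta_mx 2 0 : R3).
Local Notation sq x := (\sum_i x i ^+ 2).
Local Notation Ds := (dtau_symbol m).
Variables (Q : op) (g : ('I_3 -> C) -> 'End(V)).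
Hypothesis Qg : has_symbol Q g.
Hypothesis g_homog : forall (t : C) x, g (fun i => t * x i) = t ^+ d *: g x.
Hypothesis g_equiv : forall k xi, SO3 k ->
  (g (realpt (k *m xi)) \o tau m k = tau m k \o g (realpt xi))%VF.

Lemma realptZ (r : R) (xi : R3) : realpt (r *: xi) = (fun i => r%:C * realpt xi i).
Proof. by apply/funext => i; rewrite /realpt mxE rmorphM. Qed.

Lemma dtau_symbol_e3 : Ds (realpt e3) = dtau m (so3_basis R 2).
Proof.
rewrite /dtau_symbol (bigD1 2) //= big1 ?addr0 => [|i ne]; rewrite /realpt mxE.
  by rewrite !eqxx scale1r.
by rewrite (negbTE ne) scale0r.
Qed.

Lemma rodrigues_e3 t : rodrigues (so3_basis R 2) t *m e3 = e3.
Proof.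
apply/matrixP => i j; rewrite ord1 mxE sum3 !rodrigues_entry !mxE /=.
case: i => [[|[|[|//]]] ?]; rewrite /so3_basis /= /Y3 /mx3 ?mxE /=; ring.
Qed.

(** The value at the pole commutes with the rotations that fix the pole, hence
   with their generator. *)
Lemma symbol_at_pole : exists2 q : {poly C},
  (size q <= m.*2.+1)%N & g (realpt e3) = lhorner q (dtau m (so3_basis R 2)).
Proof.
apply: dtau2_commutant; apply: commute_dtau => t.
by have := g_equiv e3 (rodrigues_SO3 2 t); rewrite rodrigues_e3.
Qed.

(** The half turn around the first axis reverses the pole.  It multiplies the
   symbol at the pole by [(-1) ^ d], and turns the generator of the rotations
   around the pole into its opposite. *)
Lemma symbol_at_pole_parity : exists a : nat -> C,
  (forall j, a j != 0 -> (j <= m.*2)%N /\ odd j = odd d) /\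
  g (realpt e3) = \sum_(j < m.*2.+1) a j *: lpow (dtau m (so3_basis R 2)) j.
Proof.
have [q sq qE] := symbol_at_pole.
(* averaging over the half turn below erases the other coefficients *)
pose a j : C := if odd (j + d) then 0 else q`_j.
exists a; split=> [j|].
  rewrite /a oddD; case: (boolP (odd j (+) odd d)) => [|/negbTE/eqP par qj]; first by rewrite eqxx.
  split; last by move: par; case: (odd j) (odd d) => [] [].
  rewrite -ltnS; apply: leq_trans sq; rewrite ltnNge; apply: contraNN qj => sj.
  by rewrite nth_default.
set d2 := dtau m _ in qE *; set A := g _ in qE *.
pose k := rodrigues (so3_basis R 0) pi.
have Sk : SO3 k := rodrigues_SO3 0 pi.
have ke : k *m e3 = (-1) *: e3.
  apply/matrixP => i j; rewrite ord1 mxE sum3 !rodrigues_entry cospi sinpi !mxE /=.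
  case: i => [[|[|[|//]]] ?]; rewrite /so3_basis /= /Y1 /mx3 ?mxE /=; ring.
have m1 : (-1 : R)%:C = -1 by apply/eqP; rewrite eq_complex /= oppr0 !eqxx.
have gE : g (realpt ((-1) *: e3)) = (-1) ^+ d *: A.
  by rewrite realptZ m1; exact: (g_homog (-1) (realpt e3)).
have kA : ((-1) ^+ d *: A \o tau m k = tau m k \o A)%VF.
  by have := g_equiv e3 Sk; rewrite ke gE.
have kd : (tau m k \o d2 = (- 1) *: d2 \o tau m k)%VF.
  rewrite /d2 -dtau_symbol_e3 (tau_dtau_symbol m _ Sk) ke realptZ; congr (_ \o _)%VF.
  rewrite /dtau_symbol scaler_sumr; apply: eq_bigr => i _; rewrite scalerA; congr (_ *: _).
  by rewrite m1.
have AE w : (-1) ^+ d *: A w = \sum_(j < m.*2.+1) q`_j *: ((-1) ^+ j *: lpow d2 j w).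
  have -> : w = tau m k (tau m k^T w) by rewrite -comp_lfunE (tau_trK m Sk) id_lfunE.
  set w' := tau m k^T w.
  have /lfunP/(_ w') := kA; rewrite !comp_lfunE scale_lfunE => ->.
  rewrite qE (lhornerE _ _ sq) linear_sum; apply: eq_bigr => j _; rewrite linearZ /=.
  have /lfunP/(_ w') := lpow_intertwine j kd; rewrite !comp_lfunE => ->.
  by rewrite lpowZ scale_lfunE.
(* the average of the two expressions of [A], doubled *)
have two : (2 : C) != 0 by rewrite pnatr_eq0.
apply/lfunP => w; apply: (scalerI two).
have -> : 2 *: A w = A w + (-1) ^+ d *: ((-1) ^+ d *: A w).
  by rewrite scalerA -expr2 sqrr_sign scale1r scaler_nat mulr2n.
rewrite AE qE (lhornerE _ _ sq) sum_lfunE !scaler_sumr -big_split; apply: eq_bigr => j _ /=.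
rewrite !scalerA scale_lfunE scalerA -scalerDl; congr (_ *: _).
rewrite /a [_ * q`_j]mulrC -mulrA -exprD addnC -signr_odd; case: odd => /=.
  by rewrite expr1 mulrN1 subrr mulr0.
by rewrite expr0 mulr1 mulr_natl mulr2n.
Qed.

(** A rotation carries the pole to the direction of [xi].  Here [r] is a signed
   length of [xi] and [B] is the value of [dtau_symbol] in its direction. *)
Lemma symbol_expand (a : nat -> C) (xi : R3) :
  g (realpt e3) = \sum_(j < m.*2.+1) a j *: lpow (dtau m (so3_basis R 2)) j ->
  exists (r : C) (B : 'End(V)), [/\ r ^+ 2 = sq (realpt xi), Ds (realpt xi) = r *: B &
    g (realpt xi) = r ^+ d *: \sum_(j < m.*2.+1) a j *: lpow B j].
Proof.
move=> gE; have [r [k [Sk xiE rs]]] := rotation_to_axis xi.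
exists r%:C, (Ds (realpt (k *m e3))); split.
- rewrite -rmorphXn rs (raddf_sum (real_complex R)); apply: eq_bigr => i _.
  by rewrite /realpt /= rmorphXn.
- rewrite {1}xiE realptZ /dtau_symbol scaler_sumr; apply: eq_bigr => i _.
  by rewrite scalerA.
rewrite {1}xiE realptZ.
apply: etrans (g_homog r%:C (realpt (k *m e3))) _; congr (_ *: _).
apply/lfunP => w; have -> : w = tau m k (tau m k^T w) by rewrite -comp_lfunE (tau_trK m Sk) id_lfunE.
set w' := tau m k^T w.
have /lfunP/(_ w') := g_equiv e3 Sk; rewrite !comp_lfunE => ->.
rewrite gE !sum_lfunE linear_sum; apply: eq_bigr => j _; rewrite !scale_lfunE linearZ /=.
have kd : (tau m k \o dtau m (so3_basis R 2) = Ds (realpt (k *m e3)) \o tau m k)%VF.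
  by rewrite -dtau_symbol_e3; exact: tau_dtau_symbol.
by have /lfunP/(_ w') := lpow_intertwine j kd; rewrite !comp_lfunE => ->.
Qed.

Definition expansion_op (a : nat -> C) M : op :=
  \sum_(j < m.*2.+1) a j *: (opow (@laplacian R V) (M - j)./2 \o opow (@Dtau R m) j).

Definition expansion_symbol (a : nat -> C) M x : 'End(V) :=
  \sum_(j < m.*2.+1) a j *: (sq x ^+ (M - j)./2 *: lpow (Ds x) j).

Lemma has_symbol_expansion a M : has_symbol (expansion_op a M) (expansion_symbol a M).
Proof.
apply: has_symbol_sum => j; apply: has_symbolZ.
have := has_symbol_comp (has_symbol_opow (M - j)./2 (has_symbol_laplacian V))
  (has_symbol_opow j (has_symbol_Dtau R m)).
apply: has_symbol_ext => x; rewrite lpow_scaled_id; apply/lfunP => w.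
by rewrite comp_lfunE !scale_lfunE id_lfunE.
Qed.

(** The formula [f xi = sum_j a_j |xi| ^ (d - j) (D xi) ^ j], multiplied by
   [|xi| ^ (M - d)].  All exponents of [|xi|] are then even and nonnegative, so
   this is an identity between symbols of operators. *)
Lemma homogeneous_expansion (a : nat -> C) M :
  g (realpt e3) = \sum_(j < m.*2.+1) a j *: lpow (dtau m (so3_basis R 2)) j ->
  (forall j, a j != 0 -> (j <= M)%N /\ odd j = odd d) -> (d <= M)%N -> odd M = odd d ->
  opow (@laplacian R V) (M - d)./2 \o Q = expansion_op a M /\
  forall x, sq x ^+ (M - d)./2 *: g x = expansion_symbol a M x.
Proof.
move=> gE aM dM oM.
have L := has_symbol_comp (has_symbol_opow (M - d)./2 (has_symbol_laplacian V)) Qg.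
have LE x : (lpow (sq x *: (\1%VF : 'End(V))) (M - d)./2 \o g x)%VF = sq x ^+ (M - d)./2 *: g x.
  by rewrite lpow_scaled_id; apply/lfunP => w; rewrite comp_lfunE !scale_lfunE id_lfunE.
have half n : (n <= M)%N -> odd n = odd d -> ((M - n)./2.*2 + n)%N = M.
  move=> nM on; have := odd_double_half (M - n); rewrite oddB // oM on addbb add0n => ->.
  exact: subnK.
have [xi|e1 e2] := symbol_inj L (has_symbol_expansion a M).
  rewrite LE; have [r [B [rs DB ->]]] := symbol_expand xi gE.
  rewrite /expansion_symbol -rs DB -exprM mulnC muln2 scalerA -exprD half //.
  rewrite scaler_sumr; apply: eq_bigr => j _.
  have [->|aj] := eqVneq (a j) 0; first by rewrite !scale0r scaler0.
  have [jM oj] := aM j aj.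
  rewrite lpowZ !scalerA -exprM [(2 * _)%N]mulnC muln2 mulrC -mulrA -exprD.
  by rewrite half.
by split=> // x; rewrite -LE e2.
Qed.

(** Taking for [M] the largest exponent [J], and supposing [J > d], the previous
   identity at an isotropic covector reduces to its term [j = J]. *)
Lemma expansion_degree (a : nat -> C) :
  (forall j, a j != 0 -> (j <= m.*2)%N /\ odd j = odd d) ->
  g (realpt e3) = \sum_(j < m.*2.+1) a j *: lpow (dtau m (so3_basis R 2)) j ->
  forall j, a j != 0 -> (j <= d)%N.
Proof.
move=> aP gE j0 aj0; rewrite leqNgt; apply/negP => dj0.
have exJ : exists j, a j != 0 by exists j0.
have ubJ j : a j != 0 -> (j <= m.*2)%N by case/aP.
have [J aJ maxJ] := ex_maxnP exJ ubJ.
have dJ : (d < J)%N by exact: leq_trans dj0 (maxJ _ aj0).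
have [Jm oJ] := aP J aJ.
have [|_ /(_ (isotropic R))] := homogeneous_expansion (M := J) gE _ (ltnW dJ) oJ.
  by move=> j aj; split; [exact: maxJ | have [] := aP j aj].
rewrite isotropicE expr0n.
have -> : ((J - d)./2 == 0)%N = false.
  have e : ~~ odd (J - d) by rewrite oddB ?oJ ?addbb // ltnW.
  by apply/negbTE; rewrite -double_eq0 even_halfK // subn_eq0 -ltnNge.
rewrite scale0r /expansion_symbol isotropicE.
have ltJ : (J < m.*2.+1)%N by rewrite ltnS.
rewrite (bigD1 (Ordinal ltJ)) //= subnn expr0 scale1r big1 ?addr0 => [|j jJ].
  by move/esym/eqP; rewrite scaler_eq0 (negbTE aJ) (negbTE (lpow_isotropic_neq0 R Jm)).
have [->|aj] := eqVneq (a j) 0; first by rewrite scale0r.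
have [_ oj] := aP j aj; have jlt : (j < J)%N.
  by rewrite ltn_neqAle maxJ // andbT; apply: contraNneq jJ => e; apply/eqP/val_inj.
rewrite expr0n; have -> : ((J - j)./2 == 0)%N = false; last by rewrite scale0r scaler0.
have e : ~~ odd (J - j) by rewrite oddB ?oJ ?oj ?addbb // ltnW.
by apply/negbTE; rewrite -double_eq0 even_halfK // subn_eq0 -ltnNge.
Qed.

Lemma homogeneous_generated (S : set op) :
  unital_subalgebra S -> S (@laplacian R V) -> S (@Dtau R m) -> S Q.
Proof.
move=> alS SL SD; have [a [aP gE]] := symbol_at_pole_parity.
have degP := expansion_degree aP gE.
have [|] := homogeneous_expansion (M := d) gE _ (leqnn d) (erefl _).
  by move=> j aj; split; [exact: degP | have [] := aP j aj].
rewrite subnn => QE _.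
rewrite (_ : Q = expansion_op a d); last by rewrite -QE.
apply: subalgebra_sum => // j; have [_ _ SZ Sc] := alS.
by apply/SZ/Sc; exact: subalgebra_opow.
Qed.
End HomogeneousInvariants.

(** * The generation theorem *)

Lemma vector_poly_eq0 (R : realType) (W : vectType R[i]) N (c : 'I_N -> W) :
  (forall t : nat, \sum_(d < N) (t%:R : R[i]) ^+ d *: c d = 0) -> forall d, c d = 0.
Proof.
move=> c0 d; apply: vcoordP => k; rewrite {2}/vcoord linear0.
pose p : {poly R[i]} := \poly_(j < N) (if insub j is Some i then vcoord k (c i) else 0).
have pE (i : 'I_N) : p`_i = vcoord k (c i) by rewrite coef_poly ltn_ord valK.
suff p0 : p = 0 by rewrite -pE p0 coef0.
apply: poly_nat_eq0 => t; rewrite (@horner_coef_wide _ N) ?size_poly //.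
have := congr1 (vcoord k) (c0 t); rewrite /vcoord linear0 linear_sum; apply: etrans.
by apply: eq_bigr => i _; rewrite pE linearZ mulrC.
Qed.

Section InvariantsGenerated.
Variables (R : realType) (m : nat).
Local Notation C := R[i].
Local Notation V := (Harm R m).

(** Equivariance at [t xi] is a polynomial identity in [t], whose coefficients
   are the identities for the components. *)
Lemma component_equivariant N (fd : nat -> ('I_3 -> C) -> 'End(V)) (f : ('I_3 -> C) -> 'End(V)) :
  (forall x, f x = \sum_(d < N) fd d x) ->
  (forall d t x, fd d (fun i => t * x i) = t ^+ d *: fd d x) ->
  (forall k xi, SO3 k -> (f (realpt (k *m xi)) \o tau m k = tau m k \o f (realpt xi))%VF) ->
  forall (d : 'I_N) k xi, SO3 k ->
    (fd d (realpt (k *m xi)) \o tau m k = tau m k \o fd d (realpt xi))%VF.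
Proof.
move=> fE fZ fk d k xi Sk; apply/lfunP => w; rewrite !comp_lfunE.
pose c (d : 'I_N) := fd d (realpt (k *m xi)) (tau m k w) - tau m k (fd d (realpt xi) w).
suff /(_ d)/eqP : forall d, c d = 0 by rewrite subr_eq0 => /eqP.
apply: vector_poly_eq0 => t.
have fdt (e : 'I_N) (x : 'cV[R]_3) : fd e (realpt (t%:R *: x)) = t%:R ^+ e *: fd e (realpt x).
  by rewrite realptZ rmorph_nat; exact: fZ.
have := fk k (t%:R *: xi) Sk; rewrite -scalemxAr !fE => /lfunP/(_ w).
rewrite !comp_lfunE !sum_lfunE linear_sum => /eqP; rewrite -subr_eq0 -sumrB => /eqP e.
rewrite -[RHS]e; apply: eq_bigr => j _.
by rewrite !fdt !scale_lfunE linearZ /= -scalerBr.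
Qed.

Lemma invariant_sub_generated :
  @invariant_diffops R m `<=` generated_algebra [set @laplacian R V; @Dtau R m].
Proof.
move=> P [/diffop_symbol[f Pf] Pk] S [alS GS].
have SL : S (@laplacian R V) by apply: GS; left.
have SD : S (@Dtau R m) by apply: GS; right.
have [N [Pd [fd [PE Pdf fE fZ]]]] := homogeneous_components Pf.
rewrite PE; apply: subalgebra_sum => // d.
apply: (homogeneous_generated (Pdf d) (fZ d)) => // k xi Sk.
exact: (component_equivariant fE fZ (invariant_symbol Pf Pk)).
Qed.
End InvariantsGenerated.

Theorem theorem1 (R : realType) (m : nat) :
  @invariant_diffops R m =
  generated_algebra [set @laplacian R (Harm R m); @Dtau R m].
Proof.
by apply/seteqP; split; [exact: invariant_sub_generated | exact: generated_sub_invariant].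
Qed.
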